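(* Let $\mu,\nu,k$ be integers with $0\le k\le\mu<\nu$. The map $\mathcal{T}^\nu_{\mu,k}:B(\mathcal{H}_\mu)\to B(\mathcal{H}_{\mu+\nu-2k})$, $\mathcal{T}^\nu_{\mu,k}(A)=P_k(A\otimes I)P_k^*$, is completely positive, and the map $\widehat{\mathcal{T}}^\nu_{\mu,k}(A)=\frac{\mu+1}{\mu+\nu-2k+1}P_k(A\otimes I)P_k^*$ is completely positive and trace-preserving.
   Context: For an integer $\tau\ge0$, $\mathcal{H}_\tau$ is the $(\tau+1)$-dimensional space of polynomials in one complex variable of degree $\le\tau$, with inner product $\langle f,g\rangle=\int_{\mathbb{C}}f\overline{g}\,d\iota_\tau$, $d\iota_\tau(z)=\frac{\tau+1}{(1+|z|^2)^\tau}\frac{dA(z)}{\pi(1+|z|^2)^2}$ ($dA$ Lebesgue measure). $SU(2)$ acts unitarily and irreducibly on $\mathcal{H}_\tau$ by $(g\cdot f)(z)=(-\overline{b}z+\overline{a})^\tau f\big(\frac{az+b}{-\overline{b}z+\overline{a}}\big)$ where $g^{-1}=\begin{pmatrix}a&b\\-\overline b&\overline a\end{pmatrix}$. $\mathcal{H}_\mu\otimes\mathcal{H}_\nu$ is realized as polynomials $F(z,w)$ of degree $\le\mu$ in $z$, $\le\nu$ in $w$, with the inner product of $L^2(d\iota_\mu(z)d\iota_\nu(w))$; $I$ is the identity on $\mathcal{H}_\nu$. Define $J_k:\mathcal{H}_\mu\otimes\mathcal{H}_\nu\to\mathcal{H}_{\mu+\nu-2k}$ by $J_k(F)(\xi)=\int_{\mathbb{C}^2}F(z,w)(\overline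 z-\overline w)^k(1+\xi\overline z)^{\mu-k}(1+\xi\overline w)^{\nu-k}d\iota_\mu(z)d\iota_\nu(w)$, let $C_{\mu,\nu,k}>0$ be given by $C_{\mu,\nu,k}^2=\frac{(-\nu)_k(-\mu)_k}{k!(\mu+\nu-2k+2)_k}$ (rising Pochhammer symbols $(a)_n=a(a+1)\cdots(a+n-1)$), and $P_k:=C_{\mu,\nu,k}J_k$; $P_k$ is the $SU(2)$-equivariant coisometry onto the component $\mathcal{H}_{\mu+\nu-2k}$ in $\mathcal{H}_\mu\otimes\mathcal{H}_\nu\cong\bigoplus_{j=0}^\mu\mathcal{H}_{\mu+\nu-2j}$. *)

(* Defs.v *)
From HB Require Import structures.
From mathcomp Require Import all_boot all_order all_algebra.
From mathcomp Require Import all_classical all_reals all_analysis.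
From mathcomp.real_closed Require Import complex.

Set Implicit Arguments.
Unset Strict Implicit.
Unset Printing Implicit Defensive.

Import Order.TTheory GRing.Theory Num.Theory.
Local Open Scope ring_scope.
Local Open Scope complex_scope.

Section Defs.
Variable R : realType.

(* the complex plane C = R[i], identified with R * R for Lebesgue measure *)
Definition cplx (p : R * R) : R[i] := p.1 +i* p.2.

Notation leb2 := (@lebesgue_measure R \x @lebesgue_measure R)%E.
Notation leb4 := (((@lebesgue_measure R \x @lebesgue_measure R)
                    \x @lebesgue_measure R) \x @lebesgue_measure R)%E.
(* a point q = (((x1, y1), x2), y2) of R^4 encodes (z, w) = (x1 + i y1, x2 + i y2) *)
Definition cz (q : ((R * R) * R) * R) : R[i] := q.1.1.1 +i* q.1.1.2.
Definition cw (q : ((R * R) * R) * R) : R[i] := q.1.2 +i* q.2.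

Definition cintegral d (T : measurableType d) (mu : {measure set T -> \bar R})
  (h : T -> R[i]) : R[i] :=
  (Rintegral mu setT (fun x => complex.Re (h x))) +i* (Rintegral mu setT (fun x => complex.Im (h x))).

Definition nsq (z : R[i]) : R := complex.Re z ^+ 2 + complex.Im z ^+ 2.

(* density of d iota_tau with respect to dA:
   (tau+1)/(1+|z|^2)^tau * 1/(pi (1+|z|^2)^2) *)
Definition dens (tau : nat) (z : R[i]) : R :=
  (tau.+1%:R / (1 + nsq z) ^+ tau) * (1 / (pi * (1 + nsq z) ^+ 2)).

Definition Hsp (tau : nat) : set (R[i] -> R[i]) :=
  [set f | exists c : 'I_tau.+1 -> R[i], forall z, f z = \sum_(i < tau.+1) c i * z ^+ i].

(* H_mu (x) H_nu : polynomials F(z,w) of degree <= mu in z, <= nu in w *)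
Definition Hsp2 (mu nu : nat) : set (R[i] -> R[i] -> R[i]) :=
  [set F | exists c : 'I_mu.+1 -> 'I_nu.+1 -> R[i], forall z w,
      F z w = \sum_(i < mu.+1) \sum_(j < nu.+1) c i j * z ^+ i * w ^+ j].

Definition ip (tau : nat) (f g : R[i] -> R[i]) : R[i] :=
  cintegral leb2 (fun p => let z := cplx p in f z * conjc (g z) * (dens tau z)%:C).

Definition ip2 (mu nu : nat) (F G : R[i] -> R[i] -> R[i]) : R[i] :=
  cintegral leb4 (fun q => let z := cz q in let w := cw q in
    F z w * conjc (G z w) * (dens mu z * dens nu w)%:C).

(* operators: A in B(H_tau) means A maps H_tau into itself and is C-linear there *)
Definition op := (R[i] -> R[i]) -> (R[i] -> R[i]).

Definition isop (tau : nat) (A : op) : Prop :=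
  (forall f, Hsp tau f -> Hsp tau (A f)) /\
  (forall (a : R[i]) f g, Hsp tau f -> Hsp tau g ->
     A (fun z => a * f z + g z) = (fun z => a * A f z + A g z)).

Definition tensorI (A : op) (F : R[i] -> R[i] -> R[i]) : R[i] -> R[i] -> R[i] :=
  fun z w => A (fun z' => F z' w) z.

Definition poch (a : R) (n : nat) : R := \prod_(i < n) (a + i%:R).

Definition Cconst (mu nu k : nat) : R :=
  Num.sqrt (poch (- nu%:R) k * poch (- mu%:R) k /
            (k`!%:R * poch ((mu + nu - 2 * k)%N%:R + 2) k)).

Definition Jk (mu nu k : nat) (F : R[i] -> R[i] -> R[i]) : R[i] -> R[i] :=
  fun xi => cintegral leb4 (fun q => let z := cz q in let w := cw q in
    F z w * (conjc z - conjc w) ^+ k * (1 + xi * conjc z) ^+ (mu - k)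
      * (1 + xi * conjc w) ^+ (nu - k) * (dens mu z * dens nu w)%:C).

Definition Pk (mu nu k : nat) (F : R[i] -> R[i] -> R[i]) : R[i] -> R[i] :=
  fun xi => (Cconst mu nu k)%:C * Jk mu nu k F xi.

Definition is_adjoint (mu nu n : nat)
  (P : (R[i] -> R[i] -> R[i]) -> (R[i] -> R[i]))
  (Pstar : (R[i] -> R[i]) -> (R[i] -> R[i] -> R[i])) : Prop :=
  (forall g, Hsp n g -> Hsp2 mu nu (Pstar g)) /\
  (forall F g, Hsp2 mu nu F -> Hsp n g -> ip n (P F) g = ip2 mu nu F (Pstar g)).

Definition coefs (tau : nat) (f : R[i] -> R[i]) : {ffun 'I_tau.+1 -> R[i]} :=
  xget [ffun => 0] [set c : {ffun 'I_tau.+1 -> R[i]} |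
                    forall z, f z = \sum_(i < tau.+1) c i * z ^+ i].

(* trace of an operator on H_tau (basis independent; computed in the monomial basis) *)
Definition optr (tau : nat) (A : op) : R[i] :=
  \sum_(i < tau.+1) coefs tau (A (fun z => z ^+ i)) i.

(* positivity of the block operator [A_ij] on H_tau^N = C^N (x) H_tau *)
Definition blockpos (tau N : nat) (A : 'I_N -> 'I_N -> op) : Prop :=
  forall f : 'I_N -> (R[i] -> R[i]), (forall i, Hsp tau (f i)) ->
    0 <= \sum_(i < N) \sum_(j < N) ip tau (A i j (f j)) (f i).

Definition completely_positive (m n : nat) (T : op -> op) : Prop :=
  (forall A, isop m A -> isop n (T A)) /\
  (forall (N : nat) (A : 'I_N -> 'I_N -> op),
     (forall i j, isop m (A i j)) -> blockpos m A -> blockpos n (fun i j => T (A i j))).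

Definition trace_preserving (m n : nat) (T : op -> op) : Prop :=
  forall A, isop m A -> optr n (T A) = optr m A.

End Defs.

(* Main.v *)
Require Import Defs.
From HB Require Import structures.
From mathcomp Require Import all_boot all_order all_algebra.
From mathcomp Require Import all_classical all_reals all_analysis.
From mathcomp.real_closed Require Import complex.
From mathcomp Require Import measurable_realfun ring lra zify.

(** In the monomial bases everything is a finite computation once the moments of
    [d iota_tau] are known.  Stokes' theorem for z^i conj(z)^j / (1 + |z|^2)^N gives
      N m(i, j + 1, N + 1) = i m(i - 1, j, N)
    and its conjugate, which forces the orthogonality of the monomials and, starting from
    the integral of (1 + |z|^2)^-2, the value |z^i|^2 = 1 / binomial(tau, i).

    J_k is pairing with the kernel (z - w)^k (1 + xi z)^(mu - k) (1 + xi w)^(nu - k), so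
    P_k maps z^i w^j to a multiple [alpha i j] of xi^(i + j - k), and P_k^* maps xi^m to
    the sum of [beta i j] z^i w^j over i + j = m + k.  Complete positivity is the expansion
    of P_k^* f along the orthogonal basis w^j of the second factor.  Trace preservation
    says that S_i = sum_j alpha i j * beta i j equals (n + 1) / (mu + 1) for all i: the
    translation invariance of the kernel gives S_(i + 1) = S_i (this replaces Schur's
    lemma), and S_0 is a Vandermonde-type sum of binomial coefficients. *)

Set Implicit Arguments.
Unset Strict Implicit.
Unset Printing Implicit Defensive.

Import Order.TTheory GRing.Theory Num.Theory.
Import numFieldNormedType.Exports.
Local Open Scope ring_scope.
Local Open Scope complex_scope.
Local Open Scope classical_set_scope.

(** * Integrals over the real line *)

Section RealLine.
Context {R : realType}.
Notation lam := (@lebesgue_measure R).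

(** Let X be the partial trace over the second factor of P_k followed by its adjoint. The trace of
    T(A) is the trace of A X, and S_i is the i-th diagonal entry of X. Both maps respect the degree,
    so X is diagonal in the monomials; since d/dz sends z^(i+1) to (i+1) z^i, commuting with d/dz
    makes X scalar. The commutation splits into two coefficient identities, one for P_k and one for
    its adjoint, each saying that d/dz + d/dw corresponds to d/dxi. On the analytic side the plane
    measure is a product of Lebesgue measures, so Stokes' theorem becomes Fubini plus the
    fundamental theorem of calculus on horizontal and vertical lines. This dictates the growth
    conditions imposed on the integrands. An integral has a value here even for a non-integrable
    function, so integrability is carried along with every computed moment. The adjoint is known
    only through its pairing with polynomials, so it is recovered by testing against monomials. *)

Lemma integralT_even_FTC (f F : R -> R) (l : R) :
  (forall x, 0 <= f x) -> continuous f -> (forall x, f (- x) = f x) ->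
  (forall x : R, is_derive x 1 F (f x)) -> F 0 = 0 ->
  F x @[x --> +oo%R] --> l ->
  (\int[lam]_x (f x)%:E = (2 * l)%:E)%E.
Proof.
move=> f0 cf fe dF F0 Fl.
have cF x : {for x, continuous F}.
  by apply: differentiable_continuous; apply/derivable1_diffP; have [] := dF x.
rewrite ge0_symfun_integralT//; last by move=> x /=; rewrite fe.
rewrite (_ : [set x | _] = `[0, +oo[%classic); last first.
  by apply/seteqP; split => x/=; rewrite in_itv/= andbT.
rewrite (@ge0_continuous_FTC2y _ f F 0 l)//.
- by rewrite F0 sube0 -EFinM.
- exact: continuous_subspaceT.
- apply: cvg_at_right_filter; exact: cF.
- by move=> x _; rewrite derive1E; apply: derive_val.
Qed.

(** The integrand may change sign, so convergence over growing intervals comes from domination by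
    |f|. On [-(n+1), n+1] the integral is a difference of values of [F], which is why limits along
    the integers suffice. *)
Lemma integralT_FTC_eq0 (f F : R -> R) :
  lam.-integrable [set: R] (EFin \o f) -> continuous f ->
  (forall x : R, is_derive x 1 F (f x)) ->
  (F n%:R @[n --> \oo] --> 0) -> (F (- n%:R) @[n --> \oo] --> 0) ->
  (\int[lam]_x (f x)%:E = 0)%E.
Proof.
move=> intf cf dF Fp Fm.
have cF x : {for x, continuous F}.
  by apply: differentiable_continuous; apply/derivable1_diffP; have [] := dF x.
pose D n : set R := `[- n.+1%:R, n.+1%:R]%classic.
pose fn n : R -> \bar R := (EFin \o f) \_ (D n).
have mf : measurable_fun [set: R] (EFin \o f) := measurable_int _ intf.
have mfn n : measurable_fun [set: R] (fn n).
  by apply/(measurable_restrictT _ _).1; [exact: measurable_itv|exact: measurable_funTS].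
have fnf : {ae lam, forall x, setT x -> fn ^~ x @ \oo --> (EFin \o f) x}.
  apply: aeW => x _; apply: cvg_near_cst.
  exists (Num.truncn `|x|) => // n /= xn; rewrite /fn patchE mem_set//.
  rewrite /D/= in_itv/= -ler_norml ltW// (lt_le_trans (truncnS_gt _))//.
  by rewrite ler_nat.
have fng : {ae lam, forall x n, setT x -> (`|fn n x| <= (abse \o (EFin \o f)) x)%E}.
  apply: aeW => x n _; rewrite /fn patchE; case: ifPn => //= _.
  by rewrite normr0 lee_fin.
have [_ _ /=] := @dominated_convergence _ _ _ lam _ measurableT _ _ _ mfn mf fnf
  (integrable_abse intf) fng.
under eq_fun do rewrite -integral_mkcond.
have -> : (fun n => \int[lam]_(x in D n) (EFin \o f) x)%E =
          (fun n => (F n.+1%:R - F (- n.+1%:R))%:E).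
  apply/funext => n; rewrite /D; rewrite (@continuous_FTC2 _ f F).
  - by rewrite EFinB.
  - by rewrite gtrN.
  - exact: continuous_subspaceT.
  - split.
    + by move=> x _; have [] := dF x.
    + apply: cvg_at_right_filter; exact: cF.
    + apply: cvg_at_left_filter; exact: cF.
  - by move=> x _; rewrite derive1E; apply: derive_val.
move=> H; apply: cvg_unique H _ => //.
apply: cvg_EFin; first by near=> n.
suff : (F n.+1%:R - F (- n.+1%:R)) @[n --> \oo] --> (0 - 0 : R) by rewrite subr0; apply.
apply: cvgB.
  have := Fp; rewrite -(cvg_shiftS (fun n => F n%:R)); exact.
have := Fm; rewrite -(cvg_shiftS (fun n => F (- n%:R))); exact.
Unshelve. all: end_near. Qed.

Lemma cvgy_inv_bound (f : R -> R) :
  (forall x, 1 <= x -> `|f x| <= x^-1) -> f x @[x --> +oo%R] --> (0 : R).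
Proof.
move=> fx; apply/cvgrPdist_le => e e0; near=> x.
have x1 : 1 <= x by near: x; apply: nbhs_pinfty_ge; exact: num_real.
have xe : e^-1 <= x by near: x; apply: nbhs_pinfty_ge; exact: num_real.
rewrite sub0r normrN; apply: (le_trans (fx x x1)).
by rewrite invf_ple ?posrE// (lt_le_trans _ x1).
Unshelve. all: end_near. Qed.

Lemma cvgn_inv_bound (f : R -> R) :
  (forall x, 1 <= x -> `|f x| <= x^-1) -> f n%:R @[n --> \oo] --> (0 : R).
Proof. by move=> /cvgy_inv_bound/cvg_pinftyP; apply; exact: cvgr_idn. Qed.

Lemma is_derive_mul (f g : R -> R) (x df dg : R) :
  is_derive x 1 f df -> is_derive x 1 g dg ->
  is_derive x 1 (fun t => f t * g t) (df * g x + f x * dg).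
Proof.
move=> hf hg; apply: is_derive_eq; rewrite addrC /GRing.scale /= mulrC.
by congr (_ + _); rewrite mulrC.
Qed.

Lemma is_derive_inv (f : R -> R) (x df : R) : f x != 0 ->
  is_derive x 1 f df -> is_derive x 1 (fun t => (f t)^-1) (- df / f x ^+ 2).
Proof.
move=> fx hf; have h := is_deriveV fx hf; apply: (is_derive_eq h).
by rewrite /GRing.scale /= !mulNr mulrC.
Qed.

Lemma is_derive_expn (f : R -> R) (n : nat) (x df : R) : is_derive x 1 f df ->
  is_derive x 1 (fun t => f t ^+ n) (n%:R * f x ^+ n.-1 * df).
Proof.
by move=> hf; rewrite -[fun t => _]/(fun t => f t ^+ n) -exprfctE; exact: is_deriveX.
Qed.

Lemma is_derive_addsqr (r x : R) : is_derive x 1 (fun t => r + t ^+ 2) (2 * x).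
Proof.
have h := is_derive_expn 2 (is_derive_id x 1).
by apply: (is_derive_eq (is_deriveD (is_derive_cst r x 1) h)); rewrite add0r mulr1.
Qed.

Lemma is_derive_continuous (F f : R -> R) :
  (forall x : R, is_derive x 1 F (f x)) -> continuous F.
Proof.
move=> dF x; apply: differentiable_continuous; apply/derivable1_diffP.
by have [] := dF x.
Qed.

Lemma integral_inv_sqr_add1 : (\int[lam]_x ((1 + x ^+ 2)^-1)%:E = pi%:E)%E.
Proof.
rewrite (@integralT_even_FTC _ atan (pi / 2)).
- by congr _%:E; field.
- by move=> x; rewrite invr_ge0 addr_ge0// sqr_ge0.
- exact: continuous_oneDsqrV.
- by move=> x; rewrite sqrrN.
- exact: atan0.
- exact: cvgy_atan.
Qed.

Lemma integral_inv_sqr_add_sqr (r : R) : 0 < r ->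
  (\int[lam]_x (((r ^+ 2 + x ^+ 2) ^+ 2)^-1)%:E = (pi / (2 * r ^+ 3))%:E)%E.
Proof.
move=> r0; have rN0 : r != 0 by rewrite gt_eqF.
have pos x : 0 < r ^+ 2 + x ^+ 2 by rewrite ltr_pwDl ?exprn_gt0 ?sqr_ge0.
have posN x : r ^+ 2 + x ^+ 2 != 0 by rewrite gt_eqF.
have dV (x : R) := is_derive_inv (f := fun t => r ^+ 2 + t ^+ 2) (posN x)
  (is_derive_addsqr (r ^+ 2) x).
(* The derivative of x / (r^2 + x^2) is 2 r^2 / (r^2 + x^2)^2 - 1 / (r^2 + x^2); solving for the
   squared term leaves 1 / (r^2 + x^2), a multiple of an arctangent derivative. *)
pose F x := (2 * r ^+ 2)^-1 * (x * (r ^+ 2 + x ^+ 2)^-1)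
   + (2 * r ^+ 3)^-1 * atan (x * r^-1).
have dF (x : R) : is_derive x 1 F ((r ^+ 2 + x ^+ 2) ^+ 2)^-1.
  have h1 := is_derive_mul (is_derive_id x 1) (dV x).
  have h2 := @is_derive1_comp _ atan (fun t => t * r^-1) x _ _ (is_derive1_atan (x * r^-1))
    (is_derive_mul (is_derive_id x 1) (is_derive_cst r^-1 x 1)).
  apply: (is_derive_eq (is_deriveD (is_deriveZ (2 * r ^+ 2)^-1 h1)
    (is_deriveZ (2 * r ^+ 3)^-1 h2))).
  rewrite /GRing.scale /=; field; by rewrite rN0 posN.
rewrite (@integralT_even_FTC _ F (0 + (2 * r ^+ 3)^-1 * (pi / 2))).
- by congr _%:E; field.
- by move=> x; rewrite invr_ge0 sqr_ge0.
- apply: is_derive_continuous => x.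
  have h := is_derive_expn 2 (is_derive_addsqr (r ^+ 2) x).
  by apply: (is_derive_inv _ h); rewrite expf_eq0 /=.
- by move=> x; rewrite sqrrN.
- by rewrite /F mul0r mul0r atan0 !mulr0 addr0.
- rewrite /F; apply: cvgD.
    rewrite -[X in _ --> X](mulr0 (2 * r ^+ 2)^-1); apply: cvgM; first exact: cvg_cst.
    apply: cvgy_inv_bound => x x1; have x0 : 0 < x by exact: lt_le_trans x1.
    rewrite ger0_norm; last by rewrite divr_ge0 ?ltW.
    by rewrite ler_pdivrMr// mulrC ler_pdivlMr// -expr2 lerDr sqr_ge0.
  apply: cvgM; first exact: cvg_cst.
  have h : x * r^-1 @[x --> +oo%R] --> +oo%R.
    by apply: gt0_cvgMly; [rewrite invr_gt0|exact: cvg_id].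
  exact: (cvg_comp _ _ h (@cvgy_atan R)).
Qed.

Lemma integral_inv_sqrt_cube :
  (\int[lam]_x ((Num.sqrt (1 + x ^+ 2) ^+ 3)^-1)%:E = 2%:E)%E.
Proof.
have pos (x : R) : 0 < 1 + x ^+ 2 by rewrite ltr_pwDl ?sqr_ge0.
have spos (x : R) : 0 < Num.sqrt (1 + x ^+ 2) by rewrite sqrtr_gt0.
have sposN (x : R) : Num.sqrt (1 + x ^+ 2) != 0 by rewrite gt_eqF.
have dS (x : R) : is_derive x 1 (fun t : R => Num.sqrt (1 + t ^+ 2))
    ((2 * Num.sqrt (1 + x ^+ 2))^-1 * (2 * x)).
  by apply: (@is_derive1_comp _ Num.sqrt); [exact: is_derive1_sqrt|exact: is_derive_addsqr].
have dF (x : R) : is_derive x 1 (fun x : R => x * (Num.sqrt (1 + x ^+ 2))^-1)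
    (Num.sqrt (1 + x ^+ 2) ^+ 3)^-1.
  have h := is_derive_mul (is_derive_id x 1) (is_derive_inv
    (f := fun t : R => Num.sqrt (1 + t ^+ 2)) (sposN x) (dS x)).
  apply: (is_derive_eq h).
  have E : Num.sqrt (1 + x ^+ 2) ^+ 2 = 1 + x ^+ 2 by rewrite sqr_sqrtr// ltW.
  have -> : 1 * (Num.sqrt (1 + x ^+ 2))^-1 +
      x * (- ((2 * Num.sqrt (1 + x ^+ 2))^-1 * (2 * x)) / Num.sqrt (1 + x ^+ 2) ^+ 2)
    = (Num.sqrt (1 + x ^+ 2) ^+ 2 - x ^+ 2) / Num.sqrt (1 + x ^+ 2) ^+ 3 by field.
  by rewrite E addrK mul1r.
rewrite (@integralT_even_FTC _ (fun x => x * (Num.sqrt (1 + x ^+ 2))^-1) 1).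
- by rewrite mulr1.
- by move=> x; rewrite invr_ge0 exprn_ge0// ltW.
- apply: is_derive_continuous => x; have h := is_derive_expn 3 (dS x).
  by apply: (is_derive_inv _ h); rewrite expf_eq0 /=.
- by move=> x; rewrite sqrrN.
- by rewrite mul0r.
- apply: (cvg_zero (f := fun x : R => x * (Num.sqrt (1 + x ^+ 2))^-1)).
  apply: cvgy_inv_bound => x x1; have x0 : 0 < x by exact: lt_le_trans x1.
  set s := Num.sqrt _; have s0 : 0 < s by exact: spos.
  have E : s ^+ 2 = 1 + x ^+ 2 by rewrite sqr_sqrtr// ltW.
  rewrite -[X in `|X|]/(x * s^-1 - 1) ler_norml; apply/andP; split.
    rewrite -subr_ge0 (_ : _ - _ = (x ^+ 2 + s - s * x) / (s * x)); last by field; rewrite !gt_eqF.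
    by rewrite divr_ge0// ?mulr_ge0 ?(ltW s0) ?(ltW x0)//; nra.
  rewrite -subr_ge0 (_ : _ - _ = (s + s * x - x ^+ 2) / (s * x)); last by field; rewrite !gt_eqF.
  by rewrite divr_ge0// ?mulr_ge0 ?(ltW s0) ?(ltW x0)//; nra.
Qed.
End RealLine.

(** * Integration of tensor products *)

(* The canonical sigma-finite structure of the library on [m1 \x m2] is only found for
   subprobabilities; the alias below recovers it for all sigma-finite factors. *)
Section SigmaFiniteProduct.
Context d1 d2 (T1 : measurableType d1) (T2 : measurableType d2) (R : realType).
Variables (m1 : {sigma_finite_measure set T1 -> \bar R})
  (m2 : {sigma_finite_measure set T2 -> \bar R}).

Definition sf_prod : set (T1 * T2) -> \bar R := (m1 \x m2)%E.
HB.instance Definition _ := Measure.on sf_prod.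

Let sigma_finite_sf_prod : sigma_finite setT sf_prod.
Proof.
by have [] := lebesgue_integral_fubini.measure_function_Measure_isSigmaFinite__to__measure_function_isSigmaFinite
    m1 m2.
Qed.

HB.instance Definition _ :=
  @Measure_isSigmaFinite.Build _ _ _ sf_prod sigma_finite_sf_prod.

End SigmaFiniteProduct.

Section TripleProduct.
Context d1 d2 d3 (T1 : measurableType d1) (T2 : measurableType d2)
  (T3 : measurableType d3) (R : realType).
Variables (m1 : {sigma_finite_measure set T1 -> \bar R})
  (m2 : {sigma_finite_measure set T2 -> \bar R})
  (m3 : {sigma_finite_measure set T3 -> \bar R}).

Local Notation m23 := (m2 \x m3)%E.
Local Notation m123 := ((m1 \x m2) \x m3)%E.
Implicit Types (phi : T1 -> R) (psi : T2 * T3 -> R).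

(** The left-nested bracketing is that of the measure on R^4. With [T1] the plane of z, the two
    coordinates of w sit at different depths and are regrouped into a pair. *)
Definition tensor (phi : T1 -> R) (psi : T2 * T3 -> R) (q : (T1 * T2) * T3) : R :=
  phi q.1.1 * psi (q.1.2, q.2).

Lemma measurable_tensor phi psi : measurable_fun setT phi ->
  measurable_fun setT psi -> measurable_fun setT (tensor phi psi).
Proof.
move=> mphi mpsi; apply: measurable_funM.
  exact: (measurableT_comp mphi (measurableT_comp measurable_fst measurable_fst)).
apply: (measurableT_comp mpsi); apply/measurable_fun_pairP; split.
  exact: (measurableT_comp measurable_snd measurable_fst).
exact: measurable_snd.
Qed.

Lemma measurable_EFin_tensor phi psi : measurable_fun setT phi ->
  measurable_fun setT psi -> measurable_fun setT (EFin \o tensor phi psi).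
Proof.
by move=> mphi mpsi; have mt := measurable_tensor mphi mpsi; exact/measurable_EFinP.
Qed.

(** Tonelli is applied three times: the last coordinate is integrated out, then the first two are
    separated, and the two inner integrals of [psi] are reassembled over [m23]. *)
Lemma integral_tensor_ge0 phi psi : measurable_fun setT phi ->
  measurable_fun setT psi -> (forall x, 0 <= phi x) -> (forall x, 0 <= psi x) ->
  (\int[m123]_q (tensor phi psi q)%:E =
   \int[m1]_x (phi x)%:E * \int[m23]_y (psi y)%:E)%E.
Proof.
move=> mphi mpsi phi0 psi0.
have mpsiE : measurable_fun setT (EFin \o psi) by exact/measurable_EFinP.
have mphiE : measurable_fun setT (EFin \o phi) by exact/measurable_EFinP.
have psiE0 x : (0 <= (EFin \o psi) x)%E by rewrite lee_fin.
have t0 q : (0 <= (EFin \o tensor phi psi) q)%E by rewrite lee_fin mulr_ge0.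
apply: (etrans (@fubini_tonelli1 _ _ (T1 * T2)%type T3 R (sf_prod m1 m2) m3 _
  (measurable_EFin_tensor mphi mpsi) t0)).
have mF := @measurable_fun_fubini_tonelli_F _ _ _ _ _ m3 _ mpsiE psiE0.
have F0 x : (0 <= fubini_F m3 (EFin \o psi) x)%E.
  by apply: integral_ge0 => t _; exact: psiE0.
pose G p := ((phi p.1)%:E * fubini_F m3 (EFin \o psi) p.2)%E.
transitivity (\int[m1 \x m2]_p G p)%E.
  apply: eq_integral => p _; rewrite /fubini_F /tensor /G /=.
  under eq_integral do rewrite EFinM.
  rewrite ge0_integralZl_EFin//.
    by move=> t _; exact: psiE0.
  exact: (measurableT_comp mpsiE (pair1_measurable p.2)).
have mG : measurable_fun setT G.
  apply: emeasurable_funM.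
    exact: (measurableT_comp mphiE measurable_fst).
  exact: (measurableT_comp mF measurable_snd).
have G0 p : (0 <= G p)%E by rewrite /G mule_ge0// lee_fin.
apply: (etrans (@fubini_tonelli1 _ _ _ _ R m1 m2 _ mG G0)).
rewrite /fubini_F /G /=.
under eq_integral do rewrite ge0_integralZl_EFin//.
rewrite ge0_integralZr//; last 2 first.
  by move=> x _; rewrite lee_fin.
  by apply: integral_ge0 => x _; exact: F0.
by congr (_ * _)%E; rewrite fubini_tonelli1.
Qed.

Lemma integrable_tensor_ge0 phi psi :
  (forall x, 0 <= phi x) -> (forall x, 0 <= psi x) ->
  m1.-integrable setT (EFin \o phi) -> m23.-integrable setT (EFin \o psi) ->
  m123.-integrable setT (EFin \o tensor phi psi) /\
  Rintegral m123 setT (tensor phi psi) = Rintegral m1 setT phi * Rintegral m23 setT psi.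
Proof.
move=> phi0 psi0 iphi ipsi.
have /measurable_EFinP mphi := measurable_int _ iphi.
have /measurable_EFinP mpsi := measurable_int _ ipsi.
have E := integral_tensor_ge0 mphi mpsi phi0 psi0.
have fphi := integrable_fin_num measurableT iphi.
have fpsi := integrable_fin_num measurableT ipsi.
split; last by rewrite /Rintegral E fineM.
apply/integrableP; split; first exact: measurable_EFin_tensor.
under eq_integral do rewrite gee0_abs ?lee_fin ?mulr_ge0//.
by rewrite E ltey_eq fin_numM.
Qed.

(** Positive and negative parts of both factors give four nonnegative tensors, to which the previous
    lemma applies. *)
Lemma integrable_tensor phi psi :
  m1.-integrable setT (EFin \o phi) -> m23.-integrable setT (EFin \o psi) ->
  m123.-integrable setT (EFin \o tensor phi psi) /\
  Rintegral m123 setT (tensor phi psi) = Rintegral m1 setT phi * Rintegral m23 setT psi.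
Proof.
move=> iphi ipsi.
have iphip := integrable_funrpos measurableT iphi.
have iphin := integrable_funrneg measurableT iphi.
have ipsip := integrable_funrpos measurableT ipsi.
have ipsin := integrable_funrneg measurableT ipsi.
have [i1 e1] := integrable_tensor_ge0 (@funrpos_ge0 _ _ phi) (@funrpos_ge0 _ _ psi) iphip ipsip.
have [i2 e2] := integrable_tensor_ge0 (@funrneg_ge0 _ _ phi) (@funrneg_ge0 _ _ psi) iphin ipsin.
have [i3 e3] := integrable_tensor_ge0 (@funrpos_ge0 _ _ phi) (@funrneg_ge0 _ _ psi) iphip ipsin.
have [i4 e4] := integrable_tensor_ge0 (@funrneg_ge0 _ _ phi) (@funrpos_ge0 _ _ psi) iphin ipsip.
have ephi : phi = fun x => phi^\+ x - phi^\- x by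
  apply/funext => x; rewrite -[in LHS](funrposBneg phi).
have epsi : psi = fun x => psi^\+ x - psi^\- x by
  apply/funext => x; rewrite -[in LHS](funrposBneg psi).
have E : tensor phi psi = fun q => (tensor phi^\+ psi^\+ q + tensor phi^\- psi^\- q) -
   (tensor phi^\+ psi^\- q + tensor phi^\- psi^\+ q).
  by apply/funext => q; rewrite /tensor {1}ephi {1}epsi; ring.
have iD1 := integrableD measurableT i1 i2.
have iD2 := integrableD measurableT i3 i4.
split; first by rewrite E; exact: (integrableB measurableT iD1 iD2).
rewrite E RintegralB// RintegralD// RintegralD// e1 e2 e3 e4.
rewrite {5}ephi {5}epsi RintegralB// RintegralB//; ring.
Qed.

End TripleProduct.

(** * Complex-valued integrals *)

Section ComplexParts.
Context {R : realType}.
Implicit Types x y : R[i].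

Lemma cReD x y : complex.Re (x + y) = complex.Re x + complex.Re y.
Proof. by case: x y => a b [c d]. Qed.

Lemma cImD x y : complex.Im (x + y) = complex.Im x + complex.Im y.
Proof. by case: x y => a b [c d]. Qed.

Lemma cReM x y : complex.Re (x * y) =
  complex.Re x * complex.Re y - complex.Im x * complex.Im y.
Proof. by case: x y => a b [c d]. Qed.

Lemma cImM x y : complex.Im (x * y) =
  complex.Re x * complex.Im y + complex.Im x * complex.Re y.
Proof. by case: x y => a b [c d]. Qed.

Lemma nsqM x y : nsq (x * y) = nsq x * nsq y.
Proof. by rewrite /nsq cReM cImM; ring. Qed.

Lemma nsqX x n : nsq (x ^+ n) = nsq x ^+ n.
Proof.
elim: n => [|n IH]; last by rewrite !exprS nsqM IH.
by rewrite !expr0 /nsq /= expr1n expr0n addr0.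
Qed.

Lemma nsq_conjc x : nsq (conjc x) = nsq x.
Proof. by case: x => a b; rewrite /nsq /= sqrrN. Qed.

Lemma nsq_real (r : R) : nsq r%:C = r ^+ 2.
Proof. by rewrite /nsq /= expr0n addr0. Qed.

Lemma mulc_conjc x : x * conjc x = (nsq x)%:C.
Proof.
by case: x => a b; rewrite /nsq; apply/eqP; rewrite eq_complex /=;
  apply/andP; split; apply/eqP; ring.
Qed.

Lemma nsq_ge0 x : 0 <= nsq x.
Proof. by rewrite addr_ge0 ?sqr_ge0. Qed.

Lemma nsq_bound x (r : R) : 0 <= r -> nsq x <= r ^+ 2 ->
  `|complex.Re x| <= r /\ `|complex.Im x| <= r.
Proof.
move=> r0; rewrite /nsq => h.
have hr := sqr_ge0 (complex.Re x); have hi := sqr_ge0 (complex.Im x).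
by split; rewrite -(@ler_pXn2r _ 2) ?nnegrE// ?sqr_normr;
  rewrite -?normrX ?ger0_norm ?sqr_ge0//; lra.
Qed.

End ComplexParts.

Section HasComplexIntegral.
Context d (T : measurableType d) {R : realType}.
Variable mu : {measure set T -> \bar R}.
Implicit Types h : T -> R[i].

(** Linearity of the integral requires integrability of both parts, so it is bundled with the value;
    the pair is stable under sums, scalars and products of independent variables. *)
Definition has_cint h (v : R[i]) : Prop :=
  [/\ mu.-integrable setT (EFin \o (fun x => complex.Re (h x))),
      mu.-integrable setT (EFin \o (fun x => complex.Im (h x))) &
      cintegral mu h = v].

Lemma has_cintE h v : has_cint h v -> cintegral mu h = v.
Proof. by case. Qed.

Lemma eq_has_cint h1 h2 v : h1 =1 h2 -> has_cint h1 v -> has_cint h2 v.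
Proof. by move=> /funext->. Qed.

Lemma integrable_lin (a b : R) (f g : T -> R) :
  mu.-integrable setT (EFin \o f) -> mu.-integrable setT (EFin \o g) ->
  mu.-integrable setT (EFin \o (fun x => a * f x + b * g x)) /\
  Rintegral mu setT (fun x => a * f x + b * g x) =
    a * Rintegral mu setT f + b * Rintegral mu setT g.
Proof.
move=> fi gi; have fi' := integrableZl measurableT a fi.
have gi' := integrableZl measurableT b gi; split.
  exact: (integrableD measurableT fi' gi').
by rewrite RintegralD// !RintegralZl.
Qed.

Lemma has_cintD h1 h2 v1 v2 : has_cint h1 v1 -> has_cint h2 v2 ->
  has_cint (fun x => h1 x + h2 x) (v1 + v2).
Proof.
move=> [r1 i1 <-] [r2 i2 <-].
have [ir er] := integrable_lin 1 1 r1 r2; have [ii ei] := integrable_lin 1 1 i1 i2.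
have eR : (fun x => complex.Re (h1 x + h2 x)) =
   (fun x => 1 * complex.Re (h1 x) + 1 * complex.Re (h2 x)).
  by apply/funext => x; rewrite cReD !mul1r.
have eI : (fun x => complex.Im (h1 x + h2 x)) =
   (fun x => 1 * complex.Im (h1 x) + 1 * complex.Im (h2 x)).
  by apply/funext => x; rewrite cImD !mul1r.
by split; rewrite /cintegral ?eR ?eI// er ei !mul1r.
Qed.

Lemma has_cintZ (c : R[i]) h v : has_cint h v ->
  has_cint (fun x => c * h x) (c * v).
Proof.
move=> [r i <-].
have [ir er] := integrable_lin (complex.Re c) (- complex.Im c) r i.
have [ii ei] := integrable_lin (complex.Im c) (complex.Re c) r i.
have eR : (fun x => complex.Re (c * h x)) =
   (fun x => complex.Re c * complex.Re (h x) + - complex.Im c * complex.Im (h x)).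
  by apply/funext => x; rewrite cReM mulNr.
have eI : (fun x => complex.Im (c * h x)) =
   (fun x => complex.Im c * complex.Re (h x) + complex.Re c * complex.Im (h x)).
  by apply/funext => x; rewrite cImM addrC.
split; rewrite /cintegral ?eR ?eI// er ei; case: (c) => a b /=.
by apply/eqP; rewrite eq_complex /=; apply/andP; split; apply/eqP; ring.
Qed.

Lemma has_cint0 : has_cint (fun=> 0) 0.
Proof.
split; try exact: integrable0.
by rewrite /cintegral /= /Rintegral integral0.
Qed.

Lemma has_cint_sum (I : Type) (s : seq I) (P : pred I) (h : I -> T -> R[i]) (v : I -> R[i]) :
  (forall i, P i -> has_cint (h i) (v i)) ->
  has_cint (fun x => \sum_(i <- s | P i) h i x) (\sum_(i <- s | P i) v i).
Proof.
move=> H; elim: s => [|i s IH].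
  by rewrite big_nil; apply: eq_has_cint has_cint0 => x; rewrite big_nil.
rewrite big_cons; case Pi: (P i).
  apply: eq_has_cint (has_cintD (H i Pi) IH) => x.
  by rewrite big_cons Pi.
by apply: eq_has_cint IH => x; rewrite big_cons Pi.
Qed.

End HasComplexIntegral.

Section Product4.
Context {R : realType}.
Notation lam := (@lebesgue_measure R).
Notation leb2 := (@lebesgue_measure R \x @lebesgue_measure R)%E.
Notation leb4 := (((@lebesgue_measure R \x @lebesgue_measure R)
                    \x @lebesgue_measure R) \x @lebesgue_measure R)%E.

Lemma has_cint_prod (f g : R * R -> R[i]) v w :
  has_cint leb2 f v -> has_cint leb2 g w ->
  has_cint leb4 (fun q => f q.1.1 * g (q.1.2, q.2)) (v * w).
Proof.
move=> [fr fi <-] [gr gi <-].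
pose S := sf_prod lam lam.
have [rr rrE] := @integrable_tensor _ _ _ _ _ _ R S lam lam _ _ fr gr.
have [ri riE] := @integrable_tensor _ _ _ _ _ _ R S lam lam _ _ fr gi.
have [ir irE] := @integrable_tensor _ _ _ _ _ _ R S lam lam _ _ fi gr.
have [ii iiE] := @integrable_tensor _ _ _ _ _ _ R S lam lam _ _ fi gi.
have [iR eR] := integrable_lin 1 (-1) rr ii.
have [iI eI] := integrable_lin 1 1 ri ir.
have hR : (fun q : R * R * R * R => complex.Re (f q.1.1 * g (q.1.2, q.2))) =
   (fun q => 1 * tensor (fun p => complex.Re (f p)) (fun p => complex.Re (g p)) q
      + -1 * tensor (fun p => complex.Im (f p)) (fun p => complex.Im (g p)) q).
  by apply/funext => q; rewrite cReM mul1r mulN1r.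
have hI : (fun q : R * R * R * R => complex.Im (f q.1.1 * g (q.1.2, q.2))) =
   (fun q => 1 * tensor (fun p => complex.Re (f p)) (fun p => complex.Im (g p)) q
      + 1 * tensor (fun p => complex.Im (f p)) (fun p => complex.Re (g p)) q).
  by apply/funext => q; rewrite cImM !mul1r.
split; rewrite /cintegral ?hR ?hI//.
rewrite eR eI rrE iiE riE irE !mul1r mulN1r.
by apply/eqP; rewrite eq_complex /=; apply/andP; split; apply/eqP; ring.
Qed.

End Product4.

(** * Integrals over the plane *)

Section Plane.
Context {R : realType}.
Notation lam := (@lebesgue_measure R).
Notation leb2 := (@lebesgue_measure R \x @lebesgue_measure R)%E.
Implicit Types (f F : R * R -> R) (p : R * R).

Definition Dp p : R := 1 + nsq (cplx p).

Lemma Dp_ge1 p : 1 <= Dp p.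
Proof. by rewrite lerDl nsq_ge0. Qed.

Lemma Dp_gt0 p : 0 < Dp p.
Proof. exact: lt_le_trans (Dp_ge1 p). Qed.

Lemma Dp_sqr_ge_x p : 1 + p.1 ^+ 2 <= Dp p ^+ 2.
Proof.
apply: (@le_trans _ _ (Dp p)); first by rewrite /Dp /nsq /= addrA lerDl sqr_ge0.
by rewrite expr2 ler_peMl ?Dp_ge1// ltW// Dp_gt0.
Qed.

Lemma Dp_sqr_ge_y p : 1 + p.2 ^+ 2 <= Dp p ^+ 2.
Proof.
apply: (@le_trans _ _ (Dp p)).
  by rewrite /Dp /nsq /= (addrC (p.1 ^+ 2)) addrA lerDl sqr_ge0.
by rewrite expr2 ler_peMl ?Dp_ge1// ltW// Dp_gt0.
Qed.

Lemma measurable_Dp : measurable_fun setT Dp.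
Proof.
rewrite -[Dp]/(fun p => 1 + (p.1 ^+ 2 + p.2 ^+ 2)).
apply: measurable_funD => //; apply: measurable_funD; apply: measurable_funX.
  exact: measurable_fst.
exact: measurable_snd.
Qed.

Lemma measurable_invrT d (T : measurableType d) (f : T -> R) :
  measurable_fun setT f -> (forall x, 0 < f x) -> measurable_fun setT (fun x => (f x)^-1).
Proof.
move=> mf f0.
(* Positivity allows writing 1 / f as exp(- ln f), a composition of measurable functions. *)
apply: (eq_measurable_fun (fun x => expR (- ln (f x)))).
  by move=> x _; rewrite expRN lnK// posrE.
have m1 : measurable_fun setT (fun x => - ln (f x)).
  by apply: measurable_funN; apply: (@measurableT_comp _ _ _ _ _ _ (@ln R) _ f) => //;
    exact: measurable_ln.
by apply: (@measurableT_comp _ _ _ _ _ _ (@expR R) _ _ _ m1); exact: measurable_expR.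
Qed.

(** Integrating over y first, with r^2 = 1 + x^2, leaves pi / (2 r^3); the remaining integral of (1
    + x^2)^(-3/2) is 2. *)
Lemma integral_invD2 : (\int[leb2]_p ((Dp p ^+ 2)^-1)%:E = pi%:E)%E.
Proof.
have m : measurable_fun setT (EFin \o (fun p => (Dp p ^+ 2)^-1)).
  apply/measurable_EFinP; apply: measurable_invrT.
    by apply: measurable_funX; exact: measurable_Dp.
  by move=> p; rewrite exprn_gt0 ?Dp_gt0.
have p0 (p : R * R) : (0 <= ((Dp p ^+ 2)^-1)%:E)%E.
  by rewrite lee_fin invr_ge0 exprn_ge0// ltW ?Dp_gt0.
apply: (etrans (@fubini_tonelli1 _ _ _ _ R lam lam _ m p0)).
rewrite /fubini_F /=.
transitivity (\int[lam]_x ((pi / 2)%:E * ((Num.sqrt (1 + x ^+ 2) ^+ 3)^-1)%:E))%E.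
  apply: eq_integral => x _.
  have s0 : 0 < Num.sqrt (1 + x ^+ 2) by rewrite sqrtr_gt0 ltr_pwDl ?sqr_ge0.
  have := integral_inv_sqr_add_sqr s0.
  rewrite sqr_sqrtr ?addr_ge0 ?sqr_ge0// => E.
  rewrite -EFinM.
  have -> : pi / 2 * (Num.sqrt (1 + x ^+ 2) ^+ 3)^-1 = pi / (2 * Num.sqrt (1 + x ^+ 2) ^+ 3).
    by field; rewrite gt_eqF.
  rewrite -E; apply: eq_integral => y _.
  by rewrite /Dp /nsq /= addrA.
rewrite ge0_integralZl_EFin//.
- by rewrite integral_inv_sqrt_cube -EFinM; congr _%:E; field.
- apply/measurable_EFinP; apply: measurable_invrT.
    apply: measurable_funX; apply: continuous_measurable_fun => x.
    apply: (continuous_comp (f := fun x : R => 1 + x ^+ 2) (g := Num.sqrt)).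
      exact: (is_derive_continuous (is_derive_addsqr 1)).
    exact: sqrt_continuous.
  by move=> x; rewrite exprn_gt0// sqrtr_gt0 ltr_pwDl ?sqr_ge0.
- by rewrite divr_ge0// pi_ge0.
Qed.

Lemma integrable_invD2 : leb2.-integrable setT (EFin \o (fun p => (Dp p ^+ 2)^-1)).
Proof.
apply/integrableP; split.
  apply/measurable_EFinP; apply: measurable_invrT.
    by apply: measurable_funX; exact: measurable_Dp.
  by move=> p; rewrite exprn_gt0 ?Dp_gt0.
under eq_integral do rewrite /= ger0_norm ?invr_ge0 ?exprn_ge0 ?(ltW (Dp_gt0 _))//.
by rewrite integral_invD2 ltry.
Qed.

Lemma integrable_inv1D2 : lam.-integrable setT (EFin \o (fun x : R => (1 + x ^+ 2)^-1)).
Proof.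
apply/integrableP; split.
  apply/measurable_EFinP; apply: measurable_invrT.
    by apply: measurable_funD => //; apply: measurable_funX.
  by move=> x; rewrite ltr_pwDl ?sqr_ge0.
under eq_integral do rewrite /= ger0_norm ?invr_ge0 ?addr_ge0 ?sqr_ge0//.
by rewrite integral_inv_sqr_add1 ltry.
Qed.

(** The bound by a multiple of (1 + |z|^2)^-2 gives integrability on the plane and on every
    coordinate line; continuity along these lines is what the fundamental theorem of calculus asks
    for. *)
Definition tame f : Prop :=
  [/\ measurable_fun setT f,
      (forall x, continuous (fun y => f (x, y))),
      (forall y, continuous (fun x => f (x, y))) &
      exists2 K : R, 0 <= K & forall p, `|f p| <= K * (Dp p ^+ 2)^-1].

Lemma tame_lin (a b : R) f g : tame f -> tame g -> tame (fun p => a * f p + b * g p).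
Proof.
move=> [mf fx fy [K K0 fK]] [mg gx gy [L L0 gL]]; split.
- by apply: measurable_funD; apply: measurable_funM.
- by move=> x y; apply: cvgD; apply: cvgM; [exact: cvg_cst|exact: fx|exact: cvg_cst|exact: gx].
- by move=> y x; apply: cvgD; apply: cvgM; [exact: cvg_cst|exact: fy|exact: cvg_cst|exact: gy].
- exists (`|a| * K + `|b| * L); first by rewrite addr_ge0 ?mulr_ge0.
  move=> p; rewrite mulrDl; apply: (le_trans (ler_normD _ _)).
  by rewrite !normrM -!mulrA lerD// ler_wpM2l.
Qed.

Lemma tame_integrable f : tame f -> leb2.-integrable setT (EFin \o f).
Proof.
move=> [mf _ _ [K K0 fK]].
have := integrableZl measurableT K integrable_invD2.
apply: le_integrable => //; first exact/measurable_EFinP.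
by move=> p _; rewrite /= lee_fin (le_trans (fK p))// ler_norm.
Qed.

Lemma integrable_section (g : R -> R) (K : R) : continuous g ->
  (forall x, `|g x| <= K * (1 + x ^+ 2)^-1) -> lam.-integrable setT (EFin \o g).
Proof.
move=> cg gK; have := integrableZl measurableT K integrable_inv1D2.
apply: le_integrable => //; first by apply/measurable_EFinP; apply: continuous_measurable_fun.
by move=> x _; rewrite /= lee_fin (le_trans (gK x))// ler_norm.
Qed.

(** Fubini reduces to vertical lines, on each of which [f] is the derivative of a function vanishing
    at both ends. *)
Lemma integral_dy_eq0 f F : tame f ->
  (forall x y : R, is_derive y 1 (fun t => F (x, t)) (f (x, y))) ->
  (forall x y, 1 <= `|y| -> `|F (x, y)| <= `|y|^-1) ->
  Rintegral leb2 setT f = 0.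
Proof.
move=> tf dF Fb; rewrite /Rintegral -(integral12_prod_meas1 (tame_integrable tf)).
rewrite integral0_eq// => x _; rewrite /fubini_F /=.
have [_ fx _ [K K0 fK]] := tf.
apply: (@integralT_FTC_eq0 _ (fun y => f (x, y)) (fun y => F (x, y))) => //.
- apply: (@integrable_section _ K) => // y; apply: (le_trans (fK _)).
  rewrite ler_wpM2l// lef_pV2 ?posrE ?exprn_gt0 ?Dp_gt0//; last by rewrite ltr_pwDl ?sqr_ge0.
  exact: (Dp_sqr_ge_y (x, y)).
- apply: (@cvgn_inv_bound _ (fun y => F (x, y))) => y y1.
  have y0 : 0 <= y := le_trans ler01 y1.
  by rewrite -[X in X^-1](ger0_norm y0) Fb// ger0_norm.
- apply: (@cvgn_inv_bound _ (fun y => F (x, - y))) => y y1.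
  have y0 : 0 <= y := le_trans ler01 y1.
  by rewrite -[X in X^-1](ger0_norm y0) -(normrN y) Fb// normrN ger0_norm.
Qed.

Lemma integral_dx_eq0 f F : tame f ->
  (forall x y : R, is_derive x 1 (fun t => F (t, y)) (f (x, y))) ->
  (forall x y, 1 <= `|x| -> `|F (x, y)| <= `|x|^-1) ->
  Rintegral leb2 setT f = 0.
Proof.
move=> tf dF Fb; rewrite /Rintegral -(integral21_prod_meas1 (tame_integrable tf)).
rewrite integral0_eq// => y _; rewrite /fubini_G /=.
have [_ _ fy [K K0 fK]] := tf.
apply: (@integralT_FTC_eq0 _ (fun x => f (x, y)) (fun x => F (x, y))) => //.
- apply: (@integrable_section _ K) => // x; apply: (le_trans (fK _)).
  rewrite ler_wpM2l// lef_pV2 ?posrE ?exprn_gt0 ?Dp_gt0//; last by rewrite ltr_pwDl ?sqr_ge0.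
  exact: (Dp_sqr_ge_x (x, y)).
- apply: (@cvgn_inv_bound _ (fun x => F (x, y))) => x x1.
  have x0 : 0 <= x := le_trans ler01 x1.
  by rewrite -[X in X^-1](ger0_norm x0) Fb// ger0_norm.
- apply: (@cvgn_inv_bound _ (fun x => F (- x, y))) => x x1.
  have x0 : 0 <= x := le_trans ler01 x1.
  by rewrite -[X in X^-1](ger0_norm x0) -(normrN x) Fb// normrN ger0_norm.
Qed.

End Plane.

(** * Monomials and integration by parts *)

Section ComplexDerivative.
Context {R : realType}.
Implicit Types f g : R -> R[i].

Definition cder f (x : R) (d : R[i]) : Prop :=
  is_derive x 1 (fun t => complex.Re (f t)) (complex.Re d) /\
  is_derive x 1 (fun t => complex.Im (f t)) (complex.Im d).

Lemma cderM f g x df dg : cder f x df -> cder g x dg ->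
  cder (fun t => f t * g t) x (df * g x + f x * dg).
Proof.
move=> [fr fi] [gr gi]; split.
  have h := is_deriveB (is_derive_mul fr gr) (is_derive_mul fi gi).
  have -> : (fun t => complex.Re (f t * g t)) =
     ((fun t => complex.Re (f t) * complex.Re (g t)) -
      (fun t => complex.Im (f t) * complex.Im (g t))) by apply/funext => t; rewrite cReM.
  by apply: (is_derive_eq h); rewrite cReD !cReM; ring.
have h := is_deriveD (is_derive_mul fr gi) (is_derive_mul fi gr).
have -> : (fun t => complex.Im (f t * g t)) =
   ((fun t => complex.Re (f t) * complex.Im (g t)) +
    (fun t => complex.Im (f t) * complex.Re (g t))) by apply/funext => t; rewrite cImM.
by apply: (is_derive_eq h); rewrite cImD !cImM; ring.
Qed.

Lemma cder_cst (c : R[i]) x : cder (fun=> c) x 0.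
Proof. by split; exact: is_derive_cst. Qed.

Lemma cderX f n x df : cder f x df ->
  cder (fun t => f t ^+ n) x (n%:R * f x ^+ n.-1 * df).
Proof.
move=> hf; elim: n => [|n IH].
  have -> : (fun t => f t ^+ 0) = (fun=> 1) by apply/funext => t; rewrite expr0.
  by rewrite !mul0r; exact: cder_cst.
have -> : (fun t => f t ^+ n.+1) = (fun t => f t * f t ^+ n).
  by apply/funext => t; rewrite exprS.
have := cderM hf IH; congr cder.
by rewrite /= -natr1; case: n {IH} => [|n] /=; rewrite ?expr0 ?exprS; ring.
Qed.

Lemma cder_real (g : R -> R) (x dg : R) : is_derive x 1 g dg ->
  cder (fun t => (g t)%:C) x dg%:C.
Proof. by move=> hg; split => //; exact: is_derive_cst. Qed.

Lemma cder_conjc f x df : cder f x df -> cder (fun t => conjc (f t)) x (conjc df).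
Proof.
move=> [fr fi]; split.
  have -> : (fun t => complex.Re (conjc (f t))) = (fun t => complex.Re (f t)).
    by apply/funext => t; case: (f t).
  by apply: (is_derive_eq fr); case: (df).
have -> : (fun t => complex.Im (conjc (f t))) = - (fun t => complex.Im (f t)).
  by apply/funext => t; rewrite opprfctE; case: (f t).
by apply: (is_derive_eq (is_deriveN fi)); case: (df).
Qed.

Lemma is_derive_nsq f x df : cder f x df ->
  is_derive x 1 (fun t => nsq (f t))
    (2 * (complex.Re (f x) * complex.Re df + complex.Im (f x) * complex.Im df)).
Proof.
move=> [fr fi].
have h := is_deriveD (is_derive_expn 2 fr) (is_derive_expn 2 fi).
by apply: (is_derive_eq h); rewrite /= !expr1; ring.
Qed.

End ComplexDerivative.

Section Moments.
Context {R : realType}.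
Notation lam := (@lebesgue_measure R).
Notation leb2 := (@lebesgue_measure R \x @lebesgue_measure R)%E.
Implicit Types (p : R * R) (h : R * R -> R[i]).

Definition mono (i j N : nat) p : R[i] :=
  cplx p ^+ i * conjc (cplx p) ^+ j * ((Dp p ^+ N)^-1)%:C.

(** The Wirtinger derivative in z; its companion is the one in conj(z). The truncated predecessor at
    index 0 is harmless because its coefficient is 0. *)
Definition mono_dz i j N p : R[i] :=
  i%:R * mono i.-1 j N p + - N%:R * mono i j.+1 N.+1 p.
Definition mono_dzb i j N p : R[i] :=
  j%:R * mono i j.-1 N p + - N%:R * mono i.+1 j N.+1 p.

(** Chain rule along a curve with velocity [u]: taking u = 1 and u = i yields the partial
    derivatives in x and in y. *)
Lemma cder_mono (c : R -> R * R) i j N t u : cder (fun s => cplx (c s)) t u ->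
  cder (fun s => mono i j N (c s)) t
    (u * mono_dz i j N (c t) + conjc u * mono_dzb i j N (c t)).
Proof.
move=> hz; have hzb := cder_conjc hz.
have hD : is_derive t 1 (fun s => Dp (c s))
    (2 * (complex.Re (cplx (c t)) * complex.Re u + complex.Im (cplx (c t)) * complex.Im u)).
  have h := is_deriveD (is_derive_cst (1 : R) t 1) (is_derive_nsq hz).
  by rewrite add0r in h; exact: h.
set dD := 2 * _ in hD.
have DN0 : Dp (c t) != 0 by rewrite gt_eqF ?Dp_gt0.
have hE := is_derive_inv (f := fun s => Dp (c s) ^+ N) (expf_neq0 N DN0) (is_derive_expn N hD).
have := cderM (cderM (cderX i hz) (cderX j hzb)) (cder_real hE); congr cder.
have eD : dD%:C = cplx (c t) * conjc u + conjc (cplx (c t)) * u.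
  rewrite /dD; case: (cplx (c t)) => a b; case: (u) => a' b' /=.
  by apply/eqP; rewrite eq_complex /=; apply/andP; split; apply/eqP; ring.
have eE : (- (N%:R * Dp (c t) ^+ N.-1 * dD) / (Dp (c t) ^+ N) ^+ 2)%:C =
   - N%:R * (cplx (c t) * conjc u + conjc (cplx (c t)) * u) * ((Dp (c t) ^+ N.+1)^-1)%:C.
  rewrite -eD -(rmorph_nat (real_complex R)) -rmorphN -!rmorphM; congr (_%:C).
  case: (N) => [|n] /=; first by rewrite !mul0r oppr0 !mul0r.
  by rewrite !exprS; field; rewrite DN0 expf_neq0.
rewrite eE /mono_dz /mono_dzb /mono !exprS; ring.
Qed.

Lemma nsq_mono_le i j N k p : (i + j + k <= 2 * N)%N ->
  nsq (mono i j N p) <= (Dp p ^+ k)^-1.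
Proof.
move=> hk; rewrite /mono !nsqM !nsqX nsq_conjc nsq_real -exprD.
have D0 := Dp_gt0 p; have D1 := Dp_ge1 p.
have le : nsq (cplx p) ^+ (i + j) <= Dp p ^+ (i + j).
  by rewrite lerXn2r ?nnegrE ?nsq_ge0 ?(ltW D0)// /Dp lerDr.
rewrite exprVn -exprM mulnC ler_pdivrMr ?exprn_gt0// mulrC ler_pdivlMr ?exprn_gt0//.
apply: (@le_trans _ _ (Dp p ^+ (i + j) * Dp p ^+ k)).
  by rewrite ler_wpM2r// exprn_ge0// ltW.
by rewrite -exprD ler_weXn2l.
Qed.

Definition ctame h : Prop :=
  tame (fun p => complex.Re (h p)) /\ tame (fun p => complex.Im (h p)).

Lemma ctame_lin (a b : R[i]) h1 h2 : ctame h1 -> ctame h2 ->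
  ctame (fun p => a * h1 p + b * h2 p).
Proof.
move=> [r1 i1] [r2 i2]; split.
  have := tame_lin 1 1 (tame_lin (complex.Re a) (- complex.Im a) r1 i1)
    (tame_lin (complex.Re b) (- complex.Im b) r2 i2); congr tame.
  by apply/funext => p; rewrite cReD !cReM; ring.
have := tame_lin 1 1 (tame_lin (complex.Im a) (complex.Re a) r1 i1)
  (tame_lin (complex.Im b) (complex.Re b) r2 i2); congr tame.
by apply/funext => p; rewrite cImD !cImM; ring.
Qed.

Lemma ctame_has_cint h : ctame h -> has_cint leb2 h (cintegral leb2 h).
Proof. by move=> [/tame_integrable r /tame_integrable i]. Qed.

Definition cmeas h := measurable_fun setT (fun p => complex.Re (h p)) /\
  measurable_fun setT (fun p => complex.Im (h p)).

Lemma cmeasM h1 h2 : cmeas h1 -> cmeas h2 -> cmeas (fun p => h1 p * h2 p).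
Proof.
move=> [r1 i1] [r2 i2]; split.
  have -> : (fun p => complex.Re (h1 p * h2 p)) =
     (fun p => complex.Re (h1 p) * complex.Re (h2 p) - complex.Im (h1 p) * complex.Im (h2 p)).
    by apply/funext => p; rewrite cReM.
  by apply: measurable_funB; apply: measurable_funM.
have -> : (fun p => complex.Im (h1 p * h2 p)) =
   (fun p => complex.Re (h1 p) * complex.Im (h2 p) + complex.Im (h1 p) * complex.Re (h2 p)).
  by apply/funext => p; rewrite cImM.
by apply: measurable_funD; apply: measurable_funM.
Qed.

Lemma cmeasX h n : cmeas h -> cmeas (fun p => h p ^+ n).
Proof.
move=> mh; elim: n => [|n IH].
  rewrite (_ : (fun p => _) = fun=> 1); last by apply/funext => p; rewrite expr0.
  by split; exact: measurable_cst.
rewrite (_ : (fun p => _) = fun p => h p * h p ^+ n); first exact: cmeasM.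
by apply/funext => p; rewrite exprS.
Qed.

Lemma cmeas_mono i j N : cmeas (mono i j N).
Proof.
apply: cmeasM; last first.
  split; last exact: measurable_cst.
  apply: measurable_invrT; first by apply: measurable_funX; exact: measurable_Dp.
  by move=> p; rewrite exprn_gt0 ?Dp_gt0.
apply: cmeasM; apply: cmeasX; split.
- exact: measurable_fst.
- exact: measurable_snd.
- exact: measurable_fst.
- by apply: measurable_funN; exact: measurable_snd.
Qed.

Lemma cder_cplx_x (x y : R) : cder (fun s => cplx (s, y)) x 1.
Proof. by split; [exact: is_derive_id|exact: is_derive_cst]. Qed.

Lemma cder_cplx_y (x y : R) : cder (fun s => cplx (x, s)) y (0 +i* 1).
Proof. by split; [exact: is_derive_cst|exact: is_derive_id]. Qed.

Lemma ctame_mono i j N : (i + j + 4 <= 2 * N)%N -> ctame (mono i j N).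
Proof.
move=> ij; have [mr mi] := cmeas_mono i j N.
have bd p : `|complex.Re (mono i j N p)| <= 1 * (Dp p ^+ 2)^-1 /\
            `|complex.Im (mono i j N p)| <= 1 * (Dp p ^+ 2)^-1.
  rewrite mul1r; apply: nsq_bound; first by rewrite invr_ge0 exprn_ge0// ltW ?Dp_gt0.
  by rewrite exprVn -exprM; exact: nsq_mono_le.
split; split => //; try (by exists 1 => // p; have [] := bd p).
- by move=> x; apply: is_derive_continuous => y; have [] := cder_mono i j N (cder_cplx_y x y).
- by move=> y; apply: is_derive_continuous => x; have [] := cder_mono i j N (cder_cplx_x x y).
- by move=> x; apply: is_derive_continuous => y; have [] := cder_mono i j N (cder_cplx_y x y).
- by move=> y; apply: is_derive_continuous => x; have [] := cder_mono i j N (cder_cplx_x x y).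
Qed.

Lemma ctame_mono_dz i j N : (i + j + 3 <= 2 * N)%N -> ctame (mono_dz i j N).
Proof.
(* At i = 0 the first monomial need not decay fast enough, but it is multiplied by 0; the derivative
   is then a multiple of the second monomial alone. *)
move=> ij; case: i ij => [|i] ij; last by apply: ctame_lin; apply: ctame_mono => /=; lia.
have m : (0 + j.+1 + 4 <= 2 * N.+1)%N by lia.
have := ctame_lin 0 (- N%:R) (ctame_mono m) (ctame_mono m); congr ctame.
by apply/funext => p; rewrite /mono_dz !mul0r.
Qed.

Lemma ctame_mono_dzb i j N : (i + j + 3 <= 2 * N)%N -> ctame (mono_dzb i j N).
Proof.
move=> ij; case: j ij => [|j] ij; last by apply: ctame_lin; apply: ctame_mono => /=; lia.
have m : (i.+1 + 0 + 4 <= 2 * N.+1)%N by lia.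
have := ctame_lin 0 (- N%:R) (ctame_mono m) (ctame_mono m); congr ctame.
by apply/funext => p; rewrite /mono_dzb !mul0r.
Qed.

(** Boundary decay for the integration by parts: [r] stands for either real coordinate of the
    point. *)
Lemma mono_decay i j N p (r : R) : (i + j + 3 <= 2 * N)%N -> 1 <= `|r| ->
  r ^+ 2 <= Dp p ->
  `|complex.Re (mono i j N p)| <= `|r|^-1 /\ `|complex.Im (mono i j N p)| <= `|r|^-1.
Proof.
move=> ij r1 rD; have r0 : 0 < `|r| by exact: lt_le_trans r1.
apply: nsq_bound; first by rewrite invr_ge0.
have ij1 : (i + j + 1 <= 2 * N)%N by lia.
apply: (le_trans (nsq_mono_le _ ij1)).
rewrite expr1 exprVn lef_pV2 ?posrE ?Dp_gt0 ?exprn_gt0//.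
by rewrite -normrX ger0_norm ?sqr_ge0.
Qed.

(** The x-derivative is the sum of the two Wirtinger derivatives and the y-derivative is i times
    their difference. Both integrate to 0, and this linear system is invertible. *)
Lemma integral_mono_dz_dzb i j N : (i + j + 3 <= 2 * N)%N ->
  has_cint leb2 (mono_dz i j N) 0 /\ has_cint leb2 (mono_dzb i j N) 0.
Proof.
move=> ij; have tA := ctame_mono_dz ij; have tB := ctame_mono_dzb ij.
have iA := ctame_has_cint tA; have iB := ctame_has_cint tB.
have hx := ctame_lin 1 (conjc 1) tA tB.
have hy := ctame_lin (0 +i* 1) (conjc (0 +i* 1)) tA tB.
have ix := has_cintD (has_cintZ 1 iA) (has_cintZ (conjc 1) iB).
have iy := has_cintD (has_cintZ (0 +i* 1) iA) (has_cintZ (conjc (0 +i* 1)) iB).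
have Dx p : p.1 ^+ 2 <= Dp p by rewrite /Dp /nsq /= addrCA lerDl addr_ge0 ?sqr_ge0.
have Dy p : p.2 ^+ 2 <= Dp p by rewrite /Dp /nsq /= addrA lerDr addr_ge0 ?sqr_ge0.
have ex0 : cintegral leb2 (fun p => 1 * mono_dz i j N p + conjc 1 * mono_dzb i j N p) = 0.
  rewrite /cintegral; apply: (etrans (y := 0 +i* 0)) => //; congr (_ +i* _).
    apply: (@integral_dx_eq0 _ _ (fun p => complex.Re (mono i j N p)) hx.1).
      by move=> x y; have [] := cder_mono i j N (cder_cplx_x x y).
    by move=> x y x1; have [] := mono_decay (p := (x, y)) ij x1 (Dx (x, y)).
  apply: (@integral_dx_eq0 _ _ (fun p => complex.Im (mono i j N p)) hx.2).
    by move=> x y; have [] := cder_mono i j N (cder_cplx_x x y).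
  by move=> x y x1; have [] := mono_decay (p := (x, y)) ij x1 (Dx (x, y)).
have ey0 : cintegral leb2 (fun p => (0 +i* 1) * mono_dz i j N p
    + conjc (0 +i* 1) * mono_dzb i j N p) = 0.
  rewrite /cintegral; apply: (etrans (y := 0 +i* 0)) => //; congr (_ +i* _).
    apply: (@integral_dy_eq0 _ _ (fun p => complex.Re (mono i j N p)) hy.1).
      by move=> x y; have [] := cder_mono i j N (cder_cplx_y x y).
    by move=> x y y1; have [] := mono_decay (p := (x, y)) ij y1 (Dy (x, y)).
  apply: (@integral_dy_eq0 _ _ (fun p => complex.Im (mono i j N p)) hy.2).
    by move=> x y; have [] := cder_mono i j N (cder_cplx_y x y).
  by move=> x y y1; have [] := mono_decay (p := (x, y)) ij y1 (Dy (x, y)).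
have e1 := has_cintE ix; have e2 := has_cintE iy.
rewrite ex0 in e1; rewrite ey0 in e2.
move: e1 e2 iA iB; set a := cintegral _ _; set b := cintegral _ _.
case: a => a a'; case: b => b b' /eqP; rewrite eq_complex /= => /andP[/eqP e1 /eqP e2].
move=> /eqP; rewrite eq_complex /= => /andP[/eqP e3 /eqP e4].
have -> : a = 0 by lra.
have -> : a' = 0 by lra.
have -> : b = 0 by lra.
by have -> : b' = 0 by lra.
Qed.

End Moments.

(** * Moments and inner products *)

Section MomentValues.
Context {R : realType}.
Notation leb2 := (@lebesgue_measure R \x @lebesgue_measure R)%E.
Notation leb4 := (((@lebesgue_measure R \x @lebesgue_measure R)
                    \x @lebesgue_measure R) \x @lebesgue_measure R)%E.

(** The factor i stays inside the hypothesis so that for i = 0 it concerns the zero function, with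
    no condition on the integrability of the monomial itself. *)
Lemma has_cint_mono_dz i j N v : (i + j + 3 <= 2 * N.+1)%N ->
  has_cint leb2 (fun p => i%:R * @mono R i.-1 j N.+1 p) (i%:R * v) ->
  has_cint leb2 (@mono R i j.+1 N.+2) (i%:R * v / N.+1%:R).
Proof.
move=> ij hv; have [hA _] := @integral_mono_dz_dzb R i j N.+1 ij.
have nz : (N.+1%:R : R[i]) != 0 by rewrite pnatr_eq0.
have := has_cintZ (N.+1%:R^-1) (has_cintD hv (has_cintZ (-1) hA)).
rewrite mulr0 addr0 mulrC; apply: eq_has_cint => p.
by rewrite /mono_dz; field.
Qed.

Lemma has_cint_mono_dzb i j N v : (i + j + 3 <= 2 * N.+1)%N ->
  has_cint leb2 (fun p => j%:R * @mono R i j.-1 N.+1 p) (j%:R * v) ->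
  has_cint leb2 (@mono R i.+1 j N.+2) (j%:R * v / N.+1%:R).
Proof.
move=> ij hv; have [_ hB] := @integral_mono_dz_dzb R i j N.+1 ij.
have nz : (N.+1%:R : R[i]) != 0 by rewrite pnatr_eq0.
have := has_cintZ (N.+1%:R^-1) (has_cintD hv (has_cintZ (-1) hB)).
rewrite mulr0 addr0 mulrC; apply: eq_has_cint => p.
by rewrite /mono_dzb; field.
Qed.

Lemma mono00_split N (p : R * R) : mono 0 0 N p = mono 0 0 N.+1 p + mono 1 1 N.+1 p.
Proof.
rewrite /mono !expr0 !expr1 !mul1r mulc_conjc -rmorphM -rmorphD; congr (_%:C).
have D0 : Dp p != 0 by rewrite gt_eqF ?Dp_gt0.
have -> : nsq (cplx p) = Dp p - 1 by rewrite /Dp addrC addKr.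
by rewrite exprS; field; rewrite D0 expf_neq0.
Qed.

(** Splitting off |z|^2 / (1 + |z|^2)^N and integrating that term by parts gives pi/(t+1) -
    pi/((t+1)(t+2)) = pi/(t+2). *)
Lemma moment00 tau : has_cint leb2 (@mono R 0 0 tau.+2) (pi / tau.+1%:R)%:C.
Proof.
elim: tau => [|tau IH].
  have t : ctame (@mono R 0 0 2) by apply: ctame_mono.
  have [r i _] := ctame_has_cint t; split => //.
  rewrite /cintegral; congr (_ +i* _); last first.
    rewrite /Rintegral integral0_eq// => p _.
    by rewrite /mono !expr0 !mul1r.
  rewrite /Rintegral.
  transitivity (fine (pi%:E : \bar R)); last by rewrite /= divr1.
  congr fine; rewrite -integral_invD2; apply: eq_integral => p _.
  by rewrite /mono !expr0 !mul1r.
have IH' : has_cint leb2 (fun p => 1%:R * @mono R 0 0 tau.+2 p)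
    (1%:R * (pi / tau.+1%:R)%:C) by apply: has_cintZ.
have e4 : (1 + 0 + 3 <= 2 * tau.+2)%N by lia.
have h11 := has_cint_mono_dz e4 IH'.
have := has_cintD IH (has_cintZ (-1) h11).
rewrite mul1r mulN1r (_ : (_ - _ : R[i]) = (pi / tau.+2%:R)%:C).
  by apply: eq_has_cint => p; rewrite (mono00_split tau.+2) mulN1r addrK.
rewrite -(rmorph_nat (real_complex R)) -fmorphV -rmorphM -rmorphB; congr (_%:C).
have h1 : (tau.+1%:R : R) != 0 by rewrite pnatr_eq0.
have : (tau.+2%:R : R) != 0 by rewrite pnatr_eq0.
have -> : tau.+2%:R = tau.+1%:R + 1 :> R by rewrite natr1.
by move: (tau.+1%:R : R) h1 => t h1 h2; field; rewrite h1 h2.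
Qed.

(** Each integration by parts removes one z and one conj(z). If only one index reaches 0, the next
    derivative falls on a constant and the moment vanishes; if both do, [moment00] concludes. *)
Lemma moment_mono tau i j : (i <= tau)%N -> (j <= tau)%N ->
  has_cint leb2 (@mono R i j tau.+2)
    ((i == j)%:R * (pi / (tau.+1%:R * 'C(tau, i)%:R)))%:C.
Proof.
elim: tau i j => [|tau IH] i j.
  by rewrite !leqn0 => /eqP-> /eqP->; rewrite eqxx bin0 mul1r mulr1; exact: moment00.
case: i => [|i]; case: j => [|j] hi hj.
- by rewrite eqxx bin0 mul1r mulr1; exact: moment00.
- rewrite /= mul0r (_ : 0%:C = 0%:R * 0 / tau.+2%:R); last by rewrite mul0r mul0r.
  apply: has_cint_mono_dz; first by lia.
  by rewrite mul0r; apply: eq_has_cint (has_cint0 _) => p; rewrite mul0r.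
- rewrite /= mul0r (_ : 0%:C = 0%:R * 0 / tau.+2%:R); last by rewrite mul0r mul0r.
  apply: has_cint_mono_dzb; first by lia.
  by rewrite mul0r; apply: eq_has_cint (has_cint0 _) => p; rewrite mul0r.
- have h := has_cintZ (i.+1%:R) (IH i j hi hj).
  have e : (i.+1 + j + 3 <= 2 * tau.+2)%N by lia.
  have := has_cint_mono_dz e h.
  rewrite eqSS -(rmorph_nat (real_complex R)) -(rmorph_nat (real_complex R)) -fmorphV -!rmorphM.
  congr (has_cint _ _ (_%:C)); rewrite /= !natrM.
  have b : (i.+1%:R * 'C(tau.+1, i.+1)%:R = tau.+1%:R * 'C(tau, i)%:R :> R).
    by rewrite -!natrM -mul_bin_diag.
  have c0 : ('C(tau, i)%:R : R) != 0 by rewrite pnatr_eq0 -lt0n bin_gt0.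
  have c1 : ('C(tau.+1, i.+1)%:R : R) != 0 by rewrite pnatr_eq0 -lt0n bin_gt0.
  have t1 : (tau.+1%:R : R) != 0 by rewrite pnatr_eq0.
  have t2 : (tau.+2%:R : R) != 0 by rewrite pnatr_eq0.
  have i1 : (i.+1%:R : R) != 0 by rewrite pnatr_eq0.
  have -> : ('C(tau.+1, i.+1)%:R : R) = tau.+1%:R * 'C(tau, i)%:R / i.+1%:R.
    by rewrite -b mulrC mulKf.
  move: (tau.+1%:R : R) (tau.+2%:R : R) (i.+1%:R : R) t1 t2 i1 => x1 x2 x3 t1 t2 i1.
  by field; rewrite i1 c0 t1 t2.
Qed.

Lemma dens_mono tau i j (p : R * R) :
  cplx p ^+ i * conjc (cplx p) ^+ j * (dens tau (cplx p))%:C =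
  (tau.+1%:R / pi)%:C * mono i j tau.+2 p.
Proof.
rewrite /mono mulrCA -mulrA -mulrA -rmorphM; congr (_ * (_ * _%:C)).
rewrite /dens -/(Dp p).
have D0 : Dp p != 0 by rewrite gt_eqF ?Dp_gt0.
have p0 : (pi : R) != 0 by rewrite gt_eqF ?pi_gt0.
have -> : Dp p ^+ tau.+2 = Dp p ^+ tau * Dp p ^+ 2 by rewrite -exprD addn2.
have Dt := expf_neq0 tau D0.
by rewrite mul1r !invfM; ring.
Qed.

Lemma moment tau i j : (i <= tau)%N -> (j <= tau)%N ->
  has_cint leb2
    (fun p : R * R => cplx p ^+ i * conjc (cplx p) ^+ j * (dens tau (cplx p))%:C)
    ((i == j)%:R / 'C(tau, i)%:R).
Proof.
move=> hi hj; have := has_cintZ (tau.+1%:R / pi)%:C (moment_mono hi hj).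
have -> : (tau.+1%:R / pi)%:C * ((i == j)%:R * (pi / (tau.+1%:R * 'C(tau, i)%:R)))%:C =
    (i == j)%:R / 'C(tau, i)%:R :> R[i].
  have -> : (i == j)%:R / 'C(tau, i)%:R = ((i == j)%:R / 'C(tau, i)%:R : R)%:C :> R[i].
    by rewrite rmorphM fmorphV !rmorph_nat.
  rewrite -rmorphM; congr (_%:C).
  have c0 : ('C(tau, i)%:R : R) != 0 by rewrite pnatr_eq0 -lt0n bin_gt0.
  have t1 : (tau.+1%:R : R) != 0 by rewrite pnatr_eq0.
  have p0 : (pi : R) != 0 by rewrite gt_eqF ?pi_gt0.
  rewrite !invfM; move: (tau.+1%:R : R) t1 (pi : R) p0 => x1 t1 x2 p0.
  by field; rewrite ?c0 ?t1 ?p0.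
by apply: eq_has_cint => p; rewrite dens_mono.
Qed.

Lemma moment2 mu nu i j k l : (i <= mu)%N -> (j <= nu)%N -> (k <= mu)%N -> (l <= nu)%N ->
  has_cint leb4
    (fun q : R * R * R * R => cz q ^+ i * cw q ^+ j * conjc (cz q ^+ k * cw q ^+ l)
       * (dens mu (cz q) * dens nu (cw q))%:C)
    (((i == k) && (j == l))%:R / ('C(mu, i)%:R * 'C(nu, j)%:R)).
Proof.
move=> hi hj hk hl; have := has_cint_prod (moment hi hk) (moment hj hl).
rewrite mulrACA -invfM.
have -> : (i == k)%:R * (j == l)%:R = ((i == k) && (j == l))%:R :> R[i].
  by rewrite -natrM mulnb.
apply: eq_has_cint => q.
by rewrite -[cplx q.1.1]/(cz q) -[cplx (_, _)]/(cw q) !rmorphM !rmorphXn /=; ring.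
Qed.

Definition pol tau (c : 'I_tau.+1 -> R[i]) (z : R[i]) : R[i] :=
  \sum_(i < tau.+1) c i * z ^+ i.
Definition pol2 mu nu (c : 'I_mu.+1 -> 'I_nu.+1 -> R[i]) (z w : R[i]) : R[i] :=
  \sum_(i < mu.+1) \sum_(j < nu.+1) c i j * z ^+ i * w ^+ j.

Lemma ip_pol tau (a b : 'I_tau.+1 -> R[i]) :
  ip tau (pol a) (pol b) = \sum_(i < tau.+1) a i * conjc (b i) / 'C(tau, i)%:R.
Proof.
have H : has_cint leb2 (fun p : R * R =>
   \sum_(i < tau.+1) \sum_(j < tau.+1) a i * conjc (b j) *
     (cplx p ^+ i * conjc (cplx p) ^+ j * (dens tau (cplx p))%:C))
   (\sum_(i < tau.+1) \sum_(j < tau.+1) a i * conjc (b j) *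
      ((i == j :> nat)%:R / 'C(tau, i)%:R)).
  apply: has_cint_sum => i _; apply: has_cint_sum => j _; apply: has_cintZ.
  by apply: moment; rewrite -ltnS ltn_ord.
rewrite /ip; apply: etrans (etrans (has_cintE H) _); last first.
  apply: eq_bigr => i _; rewrite (bigD1 i)//= eqxx mul1r big1 ?addr0// => j ji.
  by rewrite eq_sym (inj_eq val_inj) (negbTE ji) mul0r mulr0.
congr cintegral; apply/funext => p /=.
rewrite /pol rmorph_sum big_distrlr /= mulr_suml; apply: eq_bigr => i _.
rewrite mulr_suml; apply: eq_bigr => j _.
by rewrite rmorphM rmorphXn /=; ring.
Qed.

Lemma ip2_pol2 mu nu (a b : 'I_mu.+1 -> 'I_nu.+1 -> R[i]) :
  ip2 mu nu (pol2 a) (pol2 b) =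
  \sum_(i < mu.+1) \sum_(j < nu.+1) a i j * conjc (b i j) / ('C(mu, i)%:R * 'C(nu, j)%:R).
Proof.
have H : has_cint leb4 (fun q : R * R * R * R =>
   \sum_(i < mu.+1) \sum_(j < nu.+1) \sum_(k < mu.+1) \sum_(l < nu.+1)
     a i j * conjc (b k l) *
     (cz q ^+ i * cw q ^+ j * conjc (cz q ^+ k * cw q ^+ l)
       * (dens mu (cz q) * dens nu (cw q))%:C))
   (\sum_(i < mu.+1) \sum_(j < nu.+1) \sum_(k < mu.+1) \sum_(l < nu.+1)
     a i j * conjc (b k l) *
      (((i == k :> nat) && (j == l :> nat))%:R / ('C(mu, i)%:R * 'C(nu, j)%:R))).
  do 4 (apply: has_cint_sum => ? _); apply: has_cintZ.
  by apply: moment2; rewrite -ltnS ltn_ord.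
rewrite /ip2; apply: etrans (etrans (has_cintE H) _); last first.
  apply: eq_bigr => i _; apply: eq_bigr => j _.
  rewrite (bigD1 i)//= (bigD1 j)//= !eqxx mul1r big1 ?addr0; last first.
    by move=> l lj; rewrite eq_sym (inj_eq val_inj) (negbTE lj) andbF mul0r mulr0.
  rewrite big1 ?addr0// => k ki; rewrite big1// => l _.
  by rewrite eq_sym (inj_eq val_inj) (negbTE ki) mul0r mulr0.
congr cintegral; apply/funext => q /=.
rewrite /pol2 rmorph_sum mulr_suml mulr_suml; apply: eq_bigr => i _.
rewrite mulr_suml mulr_suml; apply: eq_bigr => j _.
rewrite mulr_sumr mulr_suml; apply: eq_bigr => k _.
rewrite rmorph_sum mulr_sumr mulr_suml; apply: eq_bigr => l _.
by rewrite !rmorphM /=; ring.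
Qed.

End MomentValues.

(** * Coefficients of the kernel *)

Section Kernel.
Variables (K : comNzRingType) (a b : nat).
Implicit Types f : nat -> nat -> K.

(** [shl] and [shr] are multiplication by z and by w on arrays of coefficients. *)
Definition shl f (i j : nat) : K := if i is i'.+1 then f i' j else 0.
Definition shr f (i j : nat) : K := if j is j'.+1 then f i j' else 0.

(* [gcoef k i j] is the coefficient of z^i w^j in (z - w)^k (1 + z)^a (1 + w)^b. *)
Fixpoint gcoef (k : nat) : nat -> nat -> K :=
  if k is k'.+1 then fun i j => shl (gcoef k') i j - shr (gcoef k') i j
  else fun i j => 'C(a, i)%:R * 'C(b, j)%:R.

(** This and the next three lemmas bound the support by partial and total degree. They kill the
    terms in which a truncated subtraction or an out-of-range binomial would give a wrong value. *)
Lemma gcoef_large_i k i j : (k + a < i)%N -> gcoef k i j = 0.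
Proof.
elim: k i j => [|k IH] i j h /=; first by rewrite bin_small ?mul0r.
case: i h => // i h /=; rewrite IH; last by lia.
by case: j => [|j] /=; rewrite ?IH ?subrr//; lia.
Qed.

Lemma gcoef_large_j k i j : (k + b < j)%N -> gcoef k i j = 0.
Proof.
elim: k i j => [|k IH] i j h /=; first by rewrite [X in _ * X%:R]bin_small ?mulr0.
case: j h => // j h /=; rewrite IH; last by lia.
by case: i => [|i] /=; rewrite ?IH ?subrr//; lia.
Qed.

Lemma gcoef_small k i j : (i + j < k)%N -> gcoef k i j = 0.
Proof.
elim: k i j => [|k IH] i j h //=.
by case: i j h => [|i] [|j] h /=; rewrite ?IH ?subrr//; lia.
Qed.

Lemma gcoef_large k i j : (k + a + b < i + j)%N -> gcoef k i j = 0.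
Proof.
elim: k i j => [|k IH] i j h /=.
  case: (ltnP a i) => hi; first by rewrite bin_small ?mul0r.
  by rewrite [X in _ * X%:R]bin_small ?mulr0//; lia.
by case: i j h => [|i] [|j] h /=; rewrite ?IH ?subrr//; lia.
Qed.

Lemma mul_binS_K (n i : nat) :
  i.+1%:R * 'C(n, i.+1)%:R = (n%:R - i%:R) * 'C(n, i)%:R :> K.
Proof.
rewrite -natrM mul_bin_left natrM; case: (leqP i n) => h; first by rewrite natrB.
by rewrite bin_small ?mulr0.
Qed.

(* With G = (z - w)^k (1 + z)^a (1 + w)^b: ((1 + z) d/dz + (1 + w) d/dw) G = (k + a + b) G. *)
Lemma gcoef_lower k i j :
  i.+1%:R * gcoef k i.+1 j + j.+1%:R * gcoef k i j.+1 + (i%:R + j%:R) * gcoef k i j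
  = (k%:R + a%:R + b%:R) * gcoef k i j.
Proof.
elim: k i j => [|k IH] i j.
  rewrite /= mulrA mul_binS_K.
  have -> : j.+1%:R * ('C(a, i)%:R * 'C(b, j.+1)%:R) =
            'C(a, i)%:R * (j.+1%:R * 'C(b, j.+1)%:R) :> K by ring.
  by rewrite mul_binS_K; ring.
have hl : i%:R * gcoef k i j + j.+1%:R * shl (gcoef k) i j.+1
    + (i%:R + j%:R - 1) * shl (gcoef k) i j = (k%:R + a%:R + b%:R) * shl (gcoef k) i j.
  case: i => [|i] /=; first by ring.
  by rewrite -IH -natr1; ring.
have hr : i.+1%:R * shr (gcoef k) i.+1 j + j%:R * gcoef k i j
    + (i%:R + j%:R - 1) * shr (gcoef k) i j = (k%:R + a%:R + b%:R) * shr (gcoef k) i j.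
  case: j {hl} => [|j] /=; first by ring.
  by rewrite -IH -[j.+1%:R]natr1; ring.
rewrite [gcoef k.+1 i.+1 j]/= [gcoef k.+1 i j.+1]/= [gcoef k.+1 i j]/=.
rewrite -[k.+1%:R]natr1.
(* The extra (z - w) G appears because (1 + z) d/dz + (1 + w) d/dw fixes z - w; [hl] and [hr] are
   the induction hypothesis times z and times w. *)
transitivity ((k%:R + a%:R + b%:R) * shl (gcoef k) i j -
  (k%:R + a%:R + b%:R) * shr (gcoef k) i j + (shl (gcoef k) i j - shr (gcoef k) i j));
  last by ring.
rewrite -hl -hr -!natr1; ring.
Qed.

(* (z (1 + z) d/dz + w (1 + w) d/dw) G = (k + (k + a) z + (k + b) w) G. *)
Lemma gcoef_raise k i j :
  (i%:R + j%:R - k%:R) * gcoef k i j =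
  (k%:R + a%:R + 1 - i%:R) * shl (gcoef k) i j +
  (k%:R + b%:R + 1 - j%:R) * shr (gcoef k) i j.
Proof.
elim: k i j => [|k IH] i j.
  have hl : i%:R * ('C(a, i)%:R * 'C(b, j)%:R) =
      (a%:R + 1 - i%:R) * shl (gcoef 0) i j :> K.
    case: i => [|i] /=; first by ring.
    by rewrite mulrA mul_binS_K -natr1; ring.
  have hr : j%:R * ('C(a, i)%:R * 'C(b, j)%:R) =
      (b%:R + 1 - j%:R) * shr (gcoef 0) i j :> K.
    case: j {hl} => [|j] /=; first by ring.
    by rewrite mulrCA mul_binS_K -natr1; ring.
  by rewrite !add0r -hl -hr /=; ring.
(* Here the operator sends z - w to (z - w)(1 + z + w), which raises each of the three constants by
   one. *)
have hl : (i%:R + j%:R - k%:R - 1) * shl (gcoef k) i j =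
    (k%:R + a%:R + 2 - i%:R) * shl (shl (gcoef k)) i j +
    (k%:R + b%:R + 1 - j%:R) * shl (shr (gcoef k)) i j.
  case: i => [|i] /=; first by ring.
  have -> : i.+1%:R + j%:R - k%:R - 1 = i%:R + j%:R - k%:R :> K by rewrite -natr1; ring.
  by rewrite IH -natr1; ring.
have hr : (i%:R + j%:R - k%:R - 1) * shr (gcoef k) i j =
    (k%:R + a%:R + 1 - i%:R) * shr (shl (gcoef k)) i j +
    (k%:R + b%:R + 2 - j%:R) * shr (shr (gcoef k)) i j.
  case: j {hl} => [|j] /=; first by ring.
  have -> : i%:R + j.+1%:R - k%:R - 1 = i%:R + j%:R - k%:R :> K by rewrite -natr1; ring.
  by rewrite IH -[j.+1%:R]natr1; ring.
have ex : shr (shl (gcoef k)) i j = shl (shr (gcoef k)) i j by case: (i); case: (j).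
have el : shl (gcoef k.+1) i j = shl (shl (gcoef k)) i j - shl (shr (gcoef k)) i j.
  by case: (i) => //=; rewrite subrr.
have er : shr (gcoef k.+1) i j = shl (shr (gcoef k)) i j - shr (shr (gcoef k)) i j.
  by rewrite -ex; case: (j) => //=; rewrite subrr.
rewrite el er [gcoef k.+1 i j]/= -[k.+1%:R]natr1 mulrBr opprD addrA hl hr ex; ring.
Qed.

Lemma gcoef_0l k l : gcoef k 0 (k + l) = (-1) ^+ k * 'C(b, l)%:R.
Proof.
elim: k => [|k IH]; first by rewrite /= bin0 expr0.
by rewrite addSn /= IH sub0r exprS; ring.
Qed.

(** The powers of xi are forced by homogeneity: each z or w brings one xi, except for the k factors
    z - w. *)
Lemma gcoef_expand k (z w xi : K) :
  (z - w) ^+ k * (1 + xi * z) ^+ a * (1 + xi * w) ^+ b =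
  \sum_(i < (k + a).+1) \sum_(j < (k + b).+1)
    gcoef k i j * xi ^+ (i + j - k) * z ^+ i * w ^+ j.
Proof.
elim: k => [|k IH].
  rewrite expr0 mul1r !exprDn big_distrlr /=; apply: eq_bigr => i _; apply: eq_bigr => j _.
  by rewrite !expr1n !mul1r !exprMn subn0 exprD
    -[_ *+ 'C(a, i)]mulr_natr -[_ *+ 'C(b, j)]mulr_natr; ring.
have zz : z * ((z - w) ^+ k * (1 + xi * z) ^+ a * (1 + xi * w) ^+ b) =
   \sum_(i < (k.+1 + a).+1) \sum_(j < (k.+1 + b).+1)
     shl (gcoef k) i j * xi ^+ (i + j - k.+1) * z ^+ i * w ^+ j.
  rewrite IH addSn [RHS]big_ord_recl [X in _ = X + _]big1 ?add0r; last first.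
    by move=> j _ /=; rewrite !mul0r.
  rewrite mulr_sumr; apply: eq_bigr => i _; rewrite addSn [RHS]big_ord_recr /=.
  rewrite gcoef_large_j ?ltnSn// !mul0r addr0 mulr_sumr; apply: eq_bigr => j _.
  by rewrite /bump /= add1n addSn subSS exprS; ring.
have ww : w * ((z - w) ^+ k * (1 + xi * z) ^+ a * (1 + xi * w) ^+ b) =
   \sum_(i < (k.+1 + a).+1) \sum_(j < (k.+1 + b).+1)
     shr (gcoef k) i j * xi ^+ (i + j - k.+1) * z ^+ i * w ^+ j.
  rewrite IH addSn [RHS]big_ord_recr [X in _ = _ + X]big1 ?addr0; last first.
    move=> [[|j] hj] _ /=; first by rewrite !mul0r.
    by rewrite gcoef_large_i ?ltnSn// !mul0r.
  rewrite mulr_sumr; apply: eq_bigr => i _; rewrite addSn [RHS]big_ord_recl /=.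
  rewrite !mul0r add0r mulr_sumr; apply: eq_bigr => j _.
  by rewrite /bump /= add1n addnS subSS exprS; ring.
transitivity (z * ((z - w) ^+ k * (1 + xi * z) ^+ a * (1 + xi * w) ^+ b) -
   w * ((z - w) ^+ k * (1 + xi * z) ^+ a * (1 + xi * w) ^+ b)).
  by rewrite exprS; ring.
rewrite zz ww -sumrB; apply: eq_bigr => i _; rewrite -sumrB; apply: eq_bigr => j _ /=.
ring.
Qed.

End Kernel.

(** The coefficients are integers, so they are fixed by conjugation and pass from [R] to [R[i]]. *)
Lemma rmorph_gcoef (K L : comNzRingType) (f : {rmorphism K -> L}) a b k i j :
  f (gcoef K a b k i j) = gcoef L a b k i j.
Proof.
elim: k i j => [|k IH] i j /=; first by rewrite rmorphM !rmorph_nat.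
rewrite rmorphB; congr (_ - _); [case: i => [|i]|case: j => [|j]] => //=;
  by rewrite ?rmorph0 ?IH.
Qed.

(** Coefficient of x^b in (1 - x)^-(a+1) (1 - x)^-(k+1) = (1 - x)^-(a+k+2). *)
Lemma sum_bin_bin a b k :
  (\sum_(l < b.+1) 'C(a + b - l, a) * 'C(l + k, k) = 'C(a + b + k + 1, b))%N.
Proof.
elim: a b => [|a IHa] b.
  rewrite (eq_bigr (fun l : 'I_b.+1 => 'C(l + k, k))); last by move=> l _; rewrite bin0 mul1n.
  elim: b => [|b IHb]; first by rewrite big_ord1 add0n binn bin0.
  rewrite big_ord_recr /= IHb.
  have -> : (0 + b.+1 + k + 1 = (b + k + 1).+1)%N by lia.
  rewrite binS addnC add0n; congr (_ + _)%N.
  have -> : (b.+1 + k = b + k + 1)%N by lia.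
  by rewrite -[RHS]bin_sub; [congr 'C(_, _); lia|lia].
elim: b => [|b IHb]; first by rewrite big_ord1 subn0 addn0 binn add0n binn bin0.
have -> : (a.+1 + b.+1 + k + 1 = (a + b.+1 + k + 1).+1)%N by lia.
rewrite binS -IHa.
have -> : 'C(a + b.+1 + k + 1, b) = 'C(a.+1 + b + k + 1, b) by congr 'C(_, _); lia.
rewrite -IHb big_ord_recr [X in (_ = X + _)%N]big_ord_recr /=.
have -> : (a.+1 + b.+1 - b.+1 = a.+1)%N by lia.
have -> : (a + b.+1 - b.+1 = a)%N by lia.
rewrite !binn -addnA [X in _ = (_ + X)%N]addnC addnA; congr (_ + _)%N.
rewrite -big_split /=; apply: eq_bigr => l _.
have -> : (a.+1 + b.+1 - l = (a + b.+1 - l).+1)%N by have := ltn_ord l; lia.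
have -> : (a.+1 + b - l = a + b.+1 - l)%N by have := ltn_ord l; lia.
by rewrite binS mulnDl addnC.
Qed.

(** * Matrix coefficients of P_k and of its adjoint *)

Section Coefficients.
Variables (K : numFieldType) (a b k : nat) (c : K).
Notation g := (gcoef K a b k).

(** The inverse binomials are squared norms: those of z^i and w^j in [alpha], that of xi^(i+j-k) in
    [beta]. *)
Definition alpha (i j : nat) : K := c * g i j / ('C(k + a, i)%:R * 'C(k + b, j)%:R).
Definition beta (i j : nat) : K := c * g i j / 'C(a + b, i + j - k)%:R.

Lemma natr_bin_neq0 n m : (m <= n)%N -> ('C(n, m)%:R : K) != 0.
Proof. by move=> h; rewrite pnatr_eq0 -lt0n bin_gt0. Qed.

(** This is P_k (d/dz + d/dw) = (d/dxi) P_k on z^(i+1) w^j. The binomials in [alpha] turn the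
    raising identity of the kernel into a lowering one, as raising and lowering are adjoint. *)
Lemma alpha_lower i j : (i < k + a)%N -> (j <= k + b)%N ->
  i.+1%:R * alpha i j + j%:R * shr alpha i.+1 j =
  (i.+1%:R + j%:R - k%:R) * alpha i.+1 j.
Proof.
move=> hi hj; have R2 := gcoef_raise K a b k i.+1 j.
have B1 := natr_bin_neq0 (ltnW hi); have B1' := natr_bin_neq0 hi.
have B2' := natr_bin_neq0 hj.
have e1 : k%:R + a%:R + 1 - i.+1%:R = i.+1%:R * 'C(k + a, i.+1)%:R / 'C(k + a, i)%:R :> K.
  by rewrite mul_binS_K mulfK// natrD -natr1; ring.
have E : (i.+1%:R + j%:R - k%:R) * alpha i.+1 j =
   c * ((i.+1%:R + j%:R - k%:R) * g i.+1 j) / ('C(k + a, i.+1)%:R * 'C(k + b, j)%:R).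
  by rewrite /alpha; ring.
rewrite E R2 e1 /alpha; move: (i.+1%:R : K) {R2 E e1} => x.
case: j hj B2' => [|j] hj B2' /=; first by field; rewrite B1 B1' B2'.
have B2 := natr_bin_neq0 (ltnW hj).
have -> : k%:R + b%:R + 1 - j.+1%:R = j.+1%:R * 'C(k + b, j.+1)%:R / 'C(k + b, j)%:R :> K.
  by rewrite mul_binS_K mulfK// natrD -natr1; ring.
by move: (j.+1%:R : K) => y; field; rewrite B1 B1' B2 B2'.
Qed.

(** The dual intertwining: (d/dz + d/dw) after the adjoint equals the adjoint after d/dxi, read off
    at z^i w^j. *)
Lemma beta_lower i j : (i + j < k + a + b)%N ->
  i.+1%:R * beta i.+1 j + j.+1%:R * beta i j.+1 =
  (i.+1%:R + j%:R - k%:R) * beta i j.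
Proof.
move=> hij; have L1 := gcoef_lower K a b k i j.
have {}L1 : i.+1%:R * g i.+1 j + j.+1%:R * g i j.+1 =
    (k%:R + a%:R + b%:R - i%:R - j%:R) * g i j.
  by rewrite -[LHS](addrK ((i%:R + j%:R) * g i j)) L1; ring.
have -> : i.+1%:R * beta i.+1 j + j.+1%:R * beta i j.+1 =
   c * (i.+1%:R * g i.+1 j + j.+1%:R * g i j.+1) / 'C(a + b, (i + j).+1 - k)%:R.
  by rewrite /beta addSn addnS; ring.
rewrite L1; case: (ltnP (i + j) k) => h.
  by rewrite /beta gcoef_small// !mulr0 !mul0r mulr0.
have [m em] : {m | (i + j = m + k)%N} by exists (i + j - k)%N; lia.
rewrite /beta em -addSn !addnK.
have hm : (m < a + b)%N by lia.
have B := natr_bin_neq0 (ltnW hm); have B' := natr_bin_neq0 hm.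
have eij : i%:R + j%:R = m%:R + k%:R :> K by rewrite -!natrD em.
have -> : k%:R + a%:R + b%:R - i%:R - j%:R = m.+1%:R * 'C(a + b, m.+1)%:R / 'C(a + b, m)%:R :> K.
  rewrite mul_binS_K mulfK// natrD.
  have -> : k%:R = i%:R + j%:R - m%:R :> K by rewrite eij; ring.
  ring.
have -> : i.+1%:R + j%:R - k%:R = m.+1%:R :> K.
  rewrite -!natr1 (_ : _ - _ = i%:R + j%:R + 1 - k%:R); last by ring.
  by rewrite eij; ring.
by move: (m.+1%:R : K) => x; field; rewrite B B'.
Qed.

(* The partial trace of P* P over the second factor commutes with d/dz, so its
   diagonal entries agree; the defect is a telescoping sum over j. *)
Lemma sum_alpha_beta_step i : (i < k + a)%N ->
  \sum_(j < (k + b).+1) alpha i.+1 j * beta i.+1 j =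
  \sum_(j < (k + b).+1) alpha i j * beta i j.
Proof.
(* [t] vanishes at j = 0 through its factor j, and at j = k + b + 1 by the degree bound in w. *)
move=> hi; pose t j := j%:R * beta i j * shr alpha i.+1 j.
have key (j : 'I_(k + b).+1) :
    i.+1%:R * (alpha i.+1 j * beta i.+1 j - alpha i j * beta i j) = t j - t j.+1.
  have hj : (j <= k + b)%N by rewrite -ltnS.
  have A := alpha_lower hi hj.
  have B : (i.+1%:R * beta i.+1 j + j.+1%:R * beta i j.+1) * alpha i.+1 j =
           (i.+1%:R + j%:R - k%:R) * beta i j * alpha i.+1 j.
    (* Outside the range of [beta_lower] the total degree i + 1 + j is too large, so [alpha i.+1 j]
       is 0. *)
    case: (ltnP (i + j) (k + a + b)) => h; first by rewrite beta_lower.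
    by rewrite /alpha gcoef_large ?mulr0 ?mul0r ?mulr0//; lia.
  have {}B : i.+1%:R * (alpha i.+1 j * beta i.+1 j) =
     beta i j * ((i.+1%:R + j%:R - k%:R) * alpha i.+1 j) - t j.+1.
    have -> : beta i j * ((i.+1%:R + j%:R - k%:R) * alpha i.+1 j) =
      (i.+1%:R + j%:R - k%:R) * beta i j * alpha i.+1 j by ring.
    by rewrite -B /t /=; ring.
  by rewrite mulrBr B -A /t; ring.
apply/eqP; rewrite -subr_eq0 -sumrB -(inj_eq (mulfI (x := i.+1%:R) _)) ?pnatr_eq0// mulr0.
rewrite mulr_sumr (eq_bigr _ (fun j _ => key j)) -(big_mkord xpredT (fun j => t j - t j.+1)).
rewrite (eq_bigr (fun j => - (t j.+1 - t j))); last by move=> j _; rewrite opprB.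
rewrite sumrN telescope_sumr// /t mul0r mul0r subr0.
by rewrite /beta gcoef_large_j ?ltnSn// !mulr0 !mul0r mulr0 mul0r oppr0.
Qed.

Lemma natr_fact_neq0 n : (n`!%:R : K) != 0.
Proof. by rewrite pnatr_eq0 -lt0n fact_gt0. Qed.

Lemma natr_bin n m : (m <= n)%N ->
  'C(n, m)%:R = n`!%:R / (m`!%:R * (n - m)`!%:R) :> K.
Proof.
by move=> h; rewrite -(bin_fact h) !natrM mulfK ?mulf_neq0 ?natr_fact_neq0.
Qed.

(** For i = 0 only (-w)^k (1 + w)^b contributes, so the sum starts at j = k. The hypothesis is the
    value of the squared normalising constant. *)
Lemma sum_alpha_beta0 :
  c ^+ 2 = (k + b)`!%:R / b`!%:R * ((k + a)`!%:R / a`!%:R) *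
     (a + b).+1`!%:R / (k`!%:R * (a + b + k).+1`!%:R) ->
  \sum_(j < (k + b).+1) alpha 0 j * beta 0 j = (a + b).+1%:R / (k + a).+1%:R.
Proof.
move=> hc.
rewrite -(big_mkord xpredT (fun j => alpha 0 j * beta 0 j)).
rewrite (@big_cat_nat _ _ _ k)//=; last by lia.
rewrite big_nat big1 ?add0r; last first.
  by move=> j /andP[_ hj]; rewrite /alpha gcoef_small ?mulr0 ?mul0r.
rewrite -{1}[k]add0n big_addn (_ : (k + b).+1 - k = b.+1)%N; last by lia.
rewrite big_mkord.
(* [q] collects the factorials independent of l, leaving the summand of [sum_bin_bin]. *)
pose q := c ^+ 2 * (b`!%:R ^+ 2 * a`!%:R * k`!%:R / ((a + b)`!%:R * (k + b)`!%:R)).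
have term (l : 'I_b.+1) : alpha 0 (l + k) * beta 0 (l + k) =
    q * ('C(a + b - l, a) * 'C(l + k, k))%:R.
  have hl : (l <= b)%N by rewrite -ltnS.
  rewrite /alpha /beta (addnC l k) gcoef_0l bin0 mul1r add0n addKn natrM /q.
  have -> : c * ((-1) ^+ k * 'C(b, l)%:R) / 'C(k + b, k + l)%:R *
    (c * ((-1) ^+ k * 'C(b, l)%:R) / 'C(a + b, l)%:R) =
    c ^+ 2 * (((-1) ^+ k) ^+ 2) * ('C(b, l)%:R ^+ 2 / ('C(k + b, k + l)%:R * 'C(a + b, l)%:R)).
    by rewrite invfM; ring.
  rewrite sqrr_sign mulr1 -[RHS]mulrA; congr (_ * _).
  rewrite !natr_bin; try lia.
  have -> : (k + b - (k + l) = b - l)%N by lia.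
  have -> : (a + b - l - a = b - l)%N by lia.
  have -> : (k + l - k = l)%N by lia.
  have f1 := natr_fact_neq0 b; have f2 := natr_fact_neq0 l.
  have f3 := natr_fact_neq0 (b - l); have f4 := natr_fact_neq0 (k + b).
  have f5 := natr_fact_neq0 (k + l); have f6 := natr_fact_neq0 (a + b).
  have f7 := natr_fact_neq0 (a + b - l); have f8 := natr_fact_neq0 a.
  have f9 := natr_fact_neq0 k.
  move: (b`!%:R : K) (l`!%:R : K) ((b - l)`!%:R : K) ((k + b)`!%:R : K)
    ((k + l)`!%:R : K) ((a + b)`!%:R : K) ((a + b - l)`!%:R : K) (a`!%:R : K) (k`!%:R : K)
    f1 f2 f3 f4 f5 f6 f7 f8 f9 => x1 x2 x3 x4 x5 x6 x7 x8 x9 f1 f2 f3 f4 f5 f6 f7 f8 f9.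
  by field; rewrite ?f1 ?f2 ?f3 ?f4 ?f5 ?f6 ?f7 ?f8 ?f9.
rewrite (eq_bigr _ (fun l _ => term l)) -mulr_sumr -natr_sum sum_bin_bin natr_bin; last by lia.
have -> : (a + b + k + 1 - b = (k + a).+1)%N by lia.
rewrite /q hc addn1 !factS !natrM.
have f1 := natr_fact_neq0 b; have f4 := natr_fact_neq0 (k + b).
have f6 := natr_fact_neq0 (a + b); have f8 := natr_fact_neq0 a.
have f9 := natr_fact_neq0 k; have f5 := natr_fact_neq0 (k + a).
have f7 := natr_fact_neq0 (a + b + k).
have s1 : ((a + b).+1%:R : K) != 0 by rewrite pnatr_eq0.
have s2 : ((a + b + k).+1%:R : K) != 0 by rewrite pnatr_eq0.
have s3 : ((k + a).+1%:R : K) != 0 by rewrite pnatr_eq0.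
move: (b`!%:R : K) ((k + b)`!%:R : K) ((a + b)`!%:R : K) (a`!%:R : K) (k`!%:R : K)
  ((k + a)`!%:R : K) ((a + b + k)`!%:R : K) ((a + b).+1%:R : K) ((a + b + k).+1%:R : K)
  ((k + a).+1%:R : K) f1 f4 f6 f8 f9 f5 f7 s1 s2 s3 => x1 x4 x6 x8 x9 x5 x7 y1 y2 y3
  f1 f4 f6 f8 f9 f5 f7 s1 s2 s3.
by field; rewrite ?f1 ?f4 ?f6 ?f8 ?f9 ?f5 ?f7 ?s1 ?s2 ?s3.
Qed.

Lemma sum_alpha_beta i : (i <= k + a)%N ->
  c ^+ 2 = (k + b)`!%:R / b`!%:R * ((k + a)`!%:R / a`!%:R) *
     (a + b).+1`!%:R / (k`!%:R * (a + b + k).+1`!%:R) ->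
  \sum_(j < (k + b).+1) alpha i j * beta i j = (a + b).+1%:R / (k + a).+1%:R.
Proof.
move=> + hc; elim: i => [|i IH] hi; first exact: sum_alpha_beta0.
by rewrite sum_alpha_beta_step// IH// ltnW.
Qed.

End Coefficients.

(** * Operators in the monomial basis *)

Section Operators.
Context {R : realType}.

Lemma HspP tau (f : R[i] -> R[i]) : Hsp tau f -> exists c, f = pol (tau := tau) c.
Proof. by move=> [c fc]; exists c; apply/funext => z; rewrite fc. Qed.

Lemma Hsp_pol tau (c : 'I_tau.+1 -> R[i]) : Hsp tau (pol c).
Proof. by exists c. Qed.

Lemma Hsp2P mu nu (F : R[i] -> R[i] -> R[i]) :
  Hsp2 mu nu F -> exists c, F = pol2 (mu := mu) (nu := nu) c.
Proof. by move=> [c Fc]; exists c; apply/funext => z; apply/funext => w; rewrite Fc. Qed.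

Lemma Hsp2_pol2 mu nu (c : 'I_mu.+1 -> 'I_nu.+1 -> R[i]) : Hsp2 mu nu (pol2 c).
Proof. by exists c. Qed.

Lemma natrC_bin_neq0 n m : (m <= n)%N -> ('C(n, m)%:R : R[i]) != 0.
Proof. by move=> h; rewrite pnatr_eq0 -lt0n bin_gt0. Qed.

Lemma natr_eqD (T : finType) (V : pzSemiRingType) (i : T) (F : T -> V) :
  \sum_j (j == i)%:R * F j = F i.
Proof.
rewrite (bigD1 i)//= eqxx mul1r big1 ?addr0// => j /negbTE->.
by rewrite mul0r.
Qed.

Lemma pol_delta tau (i : 'I_tau.+1) :
  pol (fun j => (j == i)%:R) = (fun z : R[i] => z ^+ i).
Proof. by apply/funext => z; rewrite /pol natr_eqD. Qed.

(** Pairing with z^i recovers the i-th coefficient up to the nonzero squared norm. *)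
Lemma pol_inj tau (c e : 'I_tau.+1 -> R[i]) : pol c = pol e -> c =1 e.
Proof.
move=> ce i; have := ip_pol c (fun j => (j == i)%:R).
rewrite ce ip_pol => E.
have H (d : 'I_tau.+1 -> R[i]) :
    \sum_(j < tau.+1) d j * conjc (j == i)%:R / 'C(tau, j)%:R = d i / 'C(tau, i)%:R.
  rewrite -(natr_eqD i (fun j => d j / 'C(tau, j)%:R)); apply: eq_bigr => j _.
  by rewrite conjc_nat; ring.
rewrite !H in E.
have b0 : ('C(tau, i)%:R : R[i]) != 0 by apply: natrC_bin_neq0; rewrite -ltnS.
by move: E => /esym; apply: mulIf; rewrite invr_eq0.
Qed.

Lemma coefs_pol tau (c : 'I_tau.+1 -> R[i]) : coefs tau (pol c) =1 c.
Proof.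
rewrite /coefs; case: xgetP => [d _ /= dP|/(_ (finfun c))].
  by move=> i; apply/esym; apply: pol_inj; apply/funext => z; rewrite dP.
by case=> /= z; apply: eq_bigr => i _; rewrite ffunE.
Qed.

Lemma Hsp_lin tau (a : R[i]) (f g : R[i] -> R[i]) : Hsp tau f -> Hsp tau g ->
  Hsp tau (fun z => a * f z + g z).
Proof.
move=> [c fc] [e ge]; exists (fun i => a * c i + e i) => z.
rewrite fc ge mulr_sumr -big_split /=; apply: eq_bigr => i _; ring.
Qed.

Lemma Hsp0 tau : Hsp tau (fun=> 0 : R[i]).
Proof. by exists (fun=> 0) => z; rewrite big1// => i _; rewrite mul0r. Qed.

Lemma Hsp_exp tau (i : 'I_tau.+1) : Hsp tau (fun z : R[i] => z ^+ i).
Proof. by rewrite -pol_delta; exact: Hsp_pol. Qed.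

Definition opmx tau (A : op R) (i j : 'I_tau.+1) : R[i] :=
  coefs tau (A (fun z => z ^+ i)) j.

Lemma opE tau (A : op R) (c : 'I_tau.+1 -> R[i]) : isop tau A ->
  A (pol c) = pol (fun j => \sum_i c i * opmx A i j).
Proof.
move=> [AH Alin].
(* Linearity is given only for a f + g; taking a = -1 and f = g = 0 yields the empty sum needed to
   start the induction. *)
have A0 : A (fun=> 0) = fun=> 0.
  have := Alin (-1) _ _ (Hsp0 tau) (Hsp0 tau).
  have -> : (fun z : R[i] => -1 * 0 + 0 : R[i]) = (fun=> 0).
    by apply/funext => z; rewrite mulr0 addr0.
  by move=> ->; apply/funext => z; rewrite mulN1r addNr.
have Hs (s : seq 'I_tau.+1) : Hsp tau (fun z : R[i] => \sum_(i <- s) c i * z ^+ i) /\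
    A (fun z => \sum_(i <- s) c i * z ^+ i) =
    (fun z => \sum_(i <- s) c i * A (fun y => y ^+ i) z).
  elim: s => [|i s [IH1 IH2]].
    have e : (fun z : R[i] => \sum_(i <- [::]) c i * z ^+ i) = (fun=> 0).
      by apply/funext => z; rewrite big_nil.
    rewrite e A0; split; first exact: Hsp0.
    by apply/funext => z; rewrite big_nil.
  have e : (fun z : R[i] => \sum_(i <- i :: s) c i * z ^+ i) =
      (fun z => c i * z ^+ i + \sum_(i <- s) c i * z ^+ i).
    by apply/funext => z; rewrite big_cons.
  rewrite e; split; first by apply: Hsp_lin => //; exact: Hsp_exp.
  rewrite (Alin (c i) (fun z => z ^+ i)) ?IH2//; last exact: Hsp_exp.
  by apply/funext => z; rewrite big_cons.
rewrite [LHS](Hs (index_enum _)).2; apply/funext => z.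
rewrite /pol; under [RHS]eq_bigr do rewrite mulr_suml.
rewrite exchange_big; apply: eq_bigr => i _.
have [d dE] := HspP (AH _ (Hsp_exp i)).
rewrite {1}dE /pol mulr_sumr; apply: eq_bigr => j _.
by rewrite /opmx dE coefs_pol mulrA.
Qed.

Lemma isop_mx tau (B : op R) (N : 'I_tau.+1 -> 'I_tau.+1 -> R[i]) :
  (forall d, B (pol d) = pol (fun j => \sum_i d i * N i j)) ->
  isop tau B /\ optr tau B = \sum_i N i i.
Proof.
move=> BN; split; [split|].
- by move=> f /HspP[c ->]; rewrite BN; exact: Hsp_pol.
- move=> a f g /HspP[c ->] /HspP[e ->].
  have -> : (fun z => a * pol c z + pol e z) = pol (fun i => a * c i + e i).
    apply/funext => z; rewrite /pol mulr_sumr -big_split /=; apply: eq_bigr => i _; ring.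
  rewrite !BN; apply/funext => z; rewrite /pol mulr_sumr -big_split /=.
  apply: eq_bigr => j _; rewrite mulrA mulr_sumr -mulrDl -big_split /=.
  by congr (_ * _); apply: eq_bigr => i _; ring.
- apply: eq_bigr => i _; rewrite -(pol_delta i) BN coefs_pol.
  by rewrite natr_eqD.
Qed.

Lemma ipZl tau (r : R[i]) (f g : R[i] -> R[i]) : Hsp tau f -> Hsp tau g ->
  ip tau (fun z => r * f z) g = r * ip tau f g.
Proof.
move=> /HspP[c ->] /HspP[e ->].
have -> : (fun z => r * pol c z) = pol (fun i => r * c i).
  by apply/funext => z; rewrite /pol mulr_sumr; apply: eq_bigr => i _; rewrite mulrA.
by rewrite !ip_pol mulr_sumr; apply: eq_bigr => i _; rewrite !mulrA.
Qed.

Lemma tensorIE mu nu (A : op R) (e : 'I_mu.+1 -> 'I_nu.+1 -> R[i]) : isop mu A ->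
  tensorI A (pol2 e) = pol2 (fun i' j => \sum_i e i j * opmx A i i').
Proof.
move=> Aop; apply/funext => z; apply/funext => w; rewrite /tensorI.
have -> : (fun z' => pol2 e z' w) = pol (fun i => \sum_j e i j * w ^+ j).
  apply/funext => z'; rewrite /pol2 /pol; apply: eq_bigr => i _.
  by rewrite mulr_suml; apply: eq_bigr => j _; ring.
rewrite opE// /pol /pol2; apply: eq_bigr => i' _.
rewrite mulr_suml; under eq_bigr do rewrite !mulr_suml.
rewrite exchange_big; apply: eq_bigr => j _.
by rewrite !mulr_suml; apply: eq_bigr => i _; ring.
Qed.

(** Orthogonality of the w^j makes A (x) I block diagonal, with one copy of A per j weighted by
    |w^j|^2. *)
Lemma ip2_tensorI mu nu (A : op R) (e e' : 'I_mu.+1 -> 'I_nu.+1 -> R[i]) : isop mu A ->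
  ip2 mu nu (tensorI A (pol2 e)) (pol2 e') =
  \sum_(j < nu.+1) 'C(nu, j)%:R^-1 * ip mu (A (pol (e ^~ j))) (pol (e' ^~ j)).
Proof.
move=> Aop; rewrite tensorIE// ip2_pol2 exchange_big; apply: eq_bigr => j _ /=.
rewrite opE// ip_pol mulr_sumr; apply: eq_bigr => i _.
by rewrite invfM; ring.
Qed.

End Operators.

(** * The normalising constant in factorials *)

Section Constant.
Context {R : realType}.

Lemma poch_natN (N k : nat) : (k <= N)%N ->
  poch (- N%:R : R) k = (-1) ^+ k * (N`!%:R / (N - k)`!%:R).
Proof.
elim: k => [|k IH] hk.
  by rewrite /poch big_ord0 expr0 subn0 mul1r divff// natr_fact_neq0.
have [m em] : {m | N = (k + m.+1)%N} by exists (N - k.+1)%N; lia.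
rewrite /poch big_ord_recr /= -/(poch _ k) IH; last exact: ltnW.
have -> : (N - k = m.+1)%N by lia.
have -> : (N - k.+1 = m)%N by lia.
have -> : - N%:R + k%:R = - m.+1%:R :> R by rewrite em natrD; ring.
rewrite factS natrM exprS.
have f := natr_fact_neq0 R m; have s : (m.+1%:R : R) != 0 by rewrite pnatr_eq0.
move: (m.+1%:R : R) s => x s.
by field; rewrite f s.
Qed.

Lemma poch_natD2 (m k : nat) :
  poch (m%:R + 2 : R) k = (m + k).+1`!%:R / m.+1`!%:R.
Proof.
elim: k => [|k IH].
  by rewrite /poch big_ord0 addn0 divff// natr_fact_neq0.
rewrite /poch big_ord_recr /= -/(poch _ k) IH addnS [in RHS]factS natrM.
have -> : m%:R + 2 + k%:R = (m + k).+2%:R :> R by rewrite -addn2 !natrD; ring.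
by rewrite mulrC mulrA.
Qed.

Lemma Cconst_sqr (a b k : nat) :
  Cconst R (k + a) (k + b) k ^+ 2 =
  (k + b)`!%:R / b`!%:R * ((k + a)`!%:R / a`!%:R) *
     (a + b).+1`!%:R / (k`!%:R * (a + b + k).+1`!%:R).
Proof.
have E : poch (- (k + b)%:R) k * poch (- (k + a)%:R) k /
   (k`!%:R * poch ((k + a + (k + b) - 2 * k)%N%:R + 2) k) =
   (k + b)`!%:R / b`!%:R * ((k + a)`!%:R / a`!%:R) *
     (a + b).+1`!%:R / (k`!%:R * (a + b + k).+1`!%:R) :> R.
  rewrite !poch_natN ?leq_addr// !addKn.
  have -> : (k + a + (k + b) - 2 * k = a + b)%N by lia.
  rewrite poch_natD2.
  have -> : (-1) ^+ k * ((k + b)`!%:R / b`!%:R) * ((-1) ^+ k * ((k + a)`!%:R / a`!%:R)) =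
    ((-1) ^+ k) ^+ 2 * ((k + b)`!%:R / b`!%:R * ((k + a)`!%:R / a`!%:R)) :> R by ring.
  by rewrite sqrr_sign mul1r !invfM invrK; ring.
by rewrite /Cconst E sqr_sqrtr// !mulr_ge0 ?invr_ge0 ?mulr_ge0.
Qed.

End Constant.

(** * The projection and the channel *)

Section Projection.
Context {R : realType}.
Variables a b k : nat.
Notation mu := (k + a)%N.
Notation nu := (k + b)%N.
Notation n := (a + b)%N.
Notation al := (@alpha R a b k (Cconst R mu nu k)).
Notation be := (@beta R a b k (Cconst R mu nu k)).

(** The kernel is antiholomorphic in z and w, hence the conjugate of a polynomial [G] with xi
    conjugated, and J_k F(xi) is the inner product of F with [G]. *)
Lemma Jk_pol2 (c : 'I_mu.+1 -> 'I_nu.+1 -> R[i]) (xi : R[i]) :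
  Jk mu nu k (pol2 c) xi =
  \sum_(i < mu.+1) \sum_(j < nu.+1) c i j *
    (gcoef R a b k i j / ('C(mu, i)%:R * 'C(nu, j)%:R))%:C * xi ^+ (i + j - k).
Proof.
pose G z w := (z - w) ^+ k * (1 + conjc xi * z) ^+ a * (1 + conjc xi * w) ^+ b.
have GE : G = pol2 (mu := mu) (nu := nu)
    (fun i j => gcoef R[i] a b k i j * conjc xi ^+ (i + j - k)).
  by apply/funext => z; apply/funext => w; rewrite /G gcoef_expand.
have Gc z w : conjc (G z w) =
    (conjc z - conjc w) ^+ k * (1 + xi * conjc z) ^+ a * (1 + xi * conjc w) ^+ b.
  by rewrite /G !rmorphM !rmorphXn rmorphB !rmorphD rmorph1 !rmorphM /= conjcK.
have -> : Jk mu nu k (pol2 c) xi = ip2 mu nu (pol2 c) G.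
  rewrite /Jk /ip2; congr cintegral; apply/funext => q; rewrite !addKn Gc.
  by rewrite !mulrA.
rewrite GE ip2_pol2; apply: eq_bigr => i _; apply: eq_bigr => j _.
rewrite rmorphM rmorphXn /= conjcK rmorph_gcoef [in RHS]rmorphM fmorphV rmorphM !rmorph_nat.
by rewrite rmorph_gcoef; ring.
Qed.

Lemma Pk_pol2 (c : 'I_mu.+1 -> 'I_nu.+1 -> R[i]) :
  Pk mu nu k (pol2 c) = pol (tau := n)
    (fun m => \sum_(i < mu.+1) \sum_(j < nu.+1) (i + j == m + k)%N%:R * (c i j * (al i j)%:C)).
Proof.
apply/funext => xi; rewrite /Pk Jk_pol2 mulr_sumr.
have -> : pol (tau := n)
    (fun m => \sum_(i < mu.+1) \sum_(j < nu.+1) (i + j == m + k)%N%:R * (c i j * (al i j)%:C)) xi =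
  \sum_(i < mu.+1) \sum_(j < nu.+1) \sum_(m < n.+1)
    (i + j == m + k)%N%:R * (c i j * (al i j)%:C) * xi ^+ m.
  rewrite /pol; under eq_bigr do rewrite mulr_suml.
  rewrite exchange_big; apply: eq_bigr => i _.
  under eq_bigr do rewrite mulr_suml.
  by rewrite exchange_big.
apply: eq_bigr => i _; rewrite mulr_sumr; apply: eq_bigr => j _.
have -> : (Cconst R mu nu k)%:C * (c i j *
    (gcoef R a b k i j / ('C(mu, i)%:R * 'C(nu, j)%:R))%:C * xi ^+ (i + j - k)) =
    c i j * (al i j)%:C * xi ^+ (i + j - k).
  by rewrite /alpha -mulrA [in RHS]rmorphM /=; ring.
(* Outside this range no m matches, while the truncated exponent still yields a power of xi; [alpha]
   vanishes there. *)
case: (boolP (k <= i + j <= k + n)%N) => [/andP[h1 h2]|].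
  have hm : (i + j - k < n.+1)%N by lia.
  rewrite (bigD1 (Ordinal hm))//= subnK// eqxx mul1r big1 ?addr0// => m hmm.
  case: eqP => [e|]; last by rewrite !mul0r.
  by case/eqP: hmm; apply/val_inj => /=; lia.
rewrite negb_and -!ltnNge => h.
have -> : al i j = 0.
  rewrite /alpha; case/orP: h => h; first by rewrite gcoef_small// mulr0 mul0r.
  by rewrite gcoef_large ?mulr0 ?mul0r//; lia.
by rewrite rmorph0 mulr0 mul0r big1// => m _; rewrite mulr0 mul0r.
Qed.

(** Testing the adjoint relation on z^i w^j isolates one coefficient; comparing norms turns [alpha]
    into [beta], and both are real. *)
Lemma adjoint_pol (Pstar : (R[i] -> R[i]) -> (R[i] -> R[i] -> R[i])) d :
  is_adjoint mu nu n (@Pk R mu nu k) Pstar ->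
  Pstar (pol (tau := n) d) = pol2 (mu := mu) (nu := nu)
    (fun i j => \sum_(m < n.+1) (i + j == m + k)%N%:R * (d m * (be i j)%:C)).
Proof.
move=> [PH Pad]; have [e ePE] := Hsp2P (PH _ (Hsp_pol d)); rewrite ePE.
have eE (i0 : 'I_mu.+1) (j0 : 'I_nu.+1) : e i0 j0 =
    \sum_(m < n.+1) (i0 + j0 == m + k)%N%:R * (d m * (be i0 j0)%:C).
  have := Pad _ _ (Hsp2_pol2 (fun i j => (i == i0)%:R * (j == j0)%:R)) (Hsp_pol d).
  rewrite ePE ip2_pol2 Pk_pol2 ip_pol.
  have b1 : ('C(mu, i0)%:R : R) != 0 by apply: natr_bin_neq0; rewrite -ltnS.
  have b2 : ('C(nu, j0)%:R : R) != 0 by apply: natr_bin_neq0; rewrite -ltnS.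
  have -> : \sum_(i < mu.+1) \sum_(j < nu.+1) (i == i0)%:R * (j == j0)%:R * conjc (e i j) /
      ('C(mu, i)%:R * 'C(nu, j)%:R) = conjc (e i0 j0) / ('C(mu, i0)%:R * 'C(nu, j0)%:R)%:C.
    rewrite -[RHS](natr_eqD i0 (fun i => conjc (e i j0) / ('C(mu, i)%:R * 'C(nu, j0)%:R)%:C)).
    apply: eq_bigr => i _.
    rewrite -(natr_eqD j0 (fun j => conjc (e i j) / ('C(mu, i)%:R * 'C(nu, j)%:R)%:C)) mulr_sumr.
    by apply: eq_bigr => j _; rewrite [(_ * _)%:C]rmorphM !rmorph_nat; ring.
  move=> E; have {E} E : conjc (e i0 j0) =
      \sum_(m < n.+1) (i0 + j0 == m + k)%N%:R * (conjc (d m) * (be i0 j0)%:C).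
    have bb : (('C(mu, i0)%:R * 'C(nu, j0)%:R : R)%:C) != 0.
      by rewrite fmorph_eq0 mulf_neq0.
    rewrite -[LHS](divfK bb) -E mulr_suml; apply: eq_bigr => m _.
    have -> : \sum_(i < mu.+1) \sum_(j < nu.+1) (i + j == m + k)%N%:R *
        ((i == i0)%:R * (j == j0)%:R * (al i j)%:C) =
        (i0 + j0 == m + k)%N%:R * (al i0 j0)%:C.
      rewrite -[RHS](natr_eqD i0 (fun i : 'I_mu.+1 => (i + j0 == m + k)%N%:R * (al i j0)%:C)).
      apply: eq_bigr => i _.
      rewrite -(natr_eqD j0 (fun j : 'I_nu.+1 => (i + j == m + k)%N%:R * (al i j)%:C)) mulr_sumr.
      by apply: eq_bigr => j _; ring.
    case: eqP => [h|]; last by rewrite !mul0r.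
    have b3 : ('C(n, m)%:R : R) != 0 by apply: natr_bin_neq0; rewrite -ltnS.
    have -> : be i0 j0 = al i0 j0 * ('C(mu, i0)%:R * 'C(nu, j0)%:R) / 'C(n, m)%:R.
      rewrite /beta /alpha h addnK.
      by field; rewrite b1 b2 b3.
    rewrite [in RHS]rmorphM [in RHS]rmorphM fmorphV /= rmorph_nat; ring.
  rewrite -[LHS]conjcK E rmorph_sum; apply: eq_bigr => m _.
  move: (be i0 j0) => x; rewrite !rmorphM rmorph_nat.
  by rewrite [X in _ * (X * _) = _]conjcK [X in _ * (_ * X) = _]conjc_real.
by apply/funext => z; apply/funext => w; apply: eq_bigr => i _; apply: eq_bigr => j _; rewrite eE.
Qed.

Lemma conjugate_tensorI_pol (A : op R) (Pstar : (R[i] -> R[i]) -> (R[i] -> R[i] -> R[i])) d :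
  is_adjoint mu nu n (@Pk R mu nu k) Pstar -> isop mu A ->
  Pk mu nu k (tensorI A (Pstar (pol (tau := n) d))) = pol (tau := n)
    (fun m => \sum_(m' < n.+1) d m' * \sum_(i' < mu.+1) \sum_(j < nu.+1) \sum_(i < mu.+1)
       (i' + j == m + k)%N%:R * (i + j == m' + k)%N%:R *
       ((al i' j * be i j)%:C * opmx A i i')).
Proof.
move=> hP Aop; rewrite (adjoint_pol _ hP) tensorIE// Pk_pol2.
congr pol; apply/funext => m.
under [RHS]eq_bigr do rewrite mulr_sumr.
rewrite [RHS]exchange_big; apply: eq_bigr => i' _.
under [RHS]eq_bigr do rewrite mulr_sumr.
rewrite [RHS]exchange_big; apply: eq_bigr => j _.
under [RHS]eq_bigr do rewrite mulr_sumr.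
rewrite [RHS]exchange_big /= mulr_suml mulr_sumr; apply: eq_bigr => i _.
rewrite !mulr_suml mulr_sumr; apply: eq_bigr => m' _.
by rewrite [(al i' j * be i j)%:C]rmorphM /=; ring.
Qed.

(** On the diagonal both degree constraints have the same m, which forces i = i'; each diagonal
    entry of [M] is then weighted by S_i. *)
Lemma trace_conjugate_tensorI (M : 'I_mu.+1 -> 'I_mu.+1 -> R[i]) :
  \sum_(m < n.+1) \sum_(i' < mu.+1) \sum_(j < nu.+1) \sum_(i < mu.+1)
       (i' + j == m + k)%N%:R * (i + j == m + k)%N%:R *
       ((al i' j * be i j)%:C * M i i') =
  (n.+1%:R / mu.+1%:R)%:C * \sum_(i < mu.+1) M i i.
Proof.
rewrite exchange_big mulr_sumr; apply: eq_bigr => i' _ /=.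
have hi : (i' <= mu)%N by rewrite -ltnS.
rewrite -(sum_alpha_beta hi (@Cconst_sqr R a b k)) rmorph_sum mulr_suml.
rewrite exchange_big; apply: eq_bigr => j _ /=.
transitivity (\sum_(m < n.+1) (i' + j == m + k)%N%:R * ((al i' j * be i' j)%:C * M i' i')).
  apply: eq_bigr => m _; case: eqP => h; last first.
    by rewrite mul0r big1// => i _; rewrite mul0r mul0r.
  rewrite (bigD1 i')//= h eqxx !mul1r big1 ?addr0// => i ii.
  case: eqP => [h'|]; last by rewrite mulr0 mul0r.
  by case/eqP: ii; apply/val_inj => /=; lia.
rewrite -mulr_suml; case: (boolP (k <= i' + j <= k + n)%N) => [/andP[h1 h2]|].
  have hm : (i' + j - k < n.+1)%N by lia.
  rewrite (bigD1 (Ordinal hm))//= subnK// eqxx big1 ?addr0 ?mul1r// => m hmm.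
  case: eqP => [e|] //.
  by case/eqP: hmm; apply/val_inj => /=; lia.
rewrite negb_and -!ltnNge => h.
have -> : al i' j = 0.
  rewrite /alpha; case/orP: h => h; first by rewrite gcoef_small// mulr0 mul0r.
  by rewrite gcoef_large ?mulr0 ?mul0r//; lia.
by rewrite mul0r rmorph0 mul0r mulr0.
Qed.

End Projection.

Theorem mainTheorem2 (R : realType) (mu nu k : nat)
  (hk : (k <= mu)%N) (hmunu : (mu < nu)%N)
  (Pstar : (R[i] -> R[i]) -> (R[i] -> R[i] -> R[i]))
  (hPstar : is_adjoint mu nu (mu + nu - 2 * k) (@Pk R mu nu k) Pstar) :
  let n := (mu + nu - 2 * k)%N in
  let T := fun (A : op R) (g : R[i] -> R[i]) => Pk mu nu k (tensorI A (Pstar g)) in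
  let That := fun (A : op R) (g : R[i] -> R[i]) (xi : R[i]) =>
                (mu.+1%:R / n.+1%:R : R)%:C * T A g xi in
  completely_positive mu n T /\
  completely_positive mu n That /\ trace_preserving mu n That.
Proof.
(* Writing mu = k + a and nu = k + b removes truncated subtractions; the target degree becomes a +
   b. *)
have [a ea] : {a | mu = (k + a)%N} by exists (mu - k)%N; lia.
have [b eb] : {b | nu = (k + b)%N} by exists (nu - k)%N; lia.
subst mu nu.
have en : (k + a + (k + b) - 2 * k = a + b)%N by lia.
rewrite en in hPstar *; cbv zeta.
set r : R := (k + a).+1%:R / (a + b).+1%:R.
have r0 : 0 <= r%:C by rewrite lecR divr_ge0.
pose N (A : op R) (m' m : 'I_(a + b).+1) := \sum_(i' < (k + a).+1) \sum_(j < (k + b).+1)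
  \sum_(i < (k + a).+1) (i' + j == m + k)%N%:R * (i + j == m' + k)%N%:R *
  ((alpha a b k (Cconst R (k + a) (k + b) k) i' j *
    beta a b k (Cconst R (k + a) (k + b) k) i j)%:C * opmx A i i').
have TE A d : isop (k + a) A -> Pk (k + a) (k + b) k (tensorI A (Pstar (pol d))) =
    pol (fun m => \sum_m' d m' * N A m' m).
  exact: conjugate_tensorI_pol.
have ThE A d : isop (k + a) A ->
    (fun xi => r%:C * Pk (k + a) (k + b) k (tensorI A (Pstar (pol d))) xi) =
    pol (fun m => \sum_m' d m' * (r%:C * N A m' m)).
  move=> Aop; rewrite TE//; apply/funext => xi; rewrite /pol mulr_sumr.
  apply: eq_bigr => m _; rewrite mulrA mulr_sumr; congr (_ * _).
  by apply: eq_bigr => m' _; ring.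
have Top A : isop (k + a) A ->
    isop (a + b) (fun g => Pk (k + a) (k + b) k (tensorI A (Pstar g))).
  by move=> Aop; exact: (isop_mx (fun d => TE A d Aop)).1.
have CPT : completely_positive (k + a) (a + b)
    (fun A g => Pk (k + a) (k + b) k (tensorI A (Pstar g))).
  split; first exact: Top.
  move=> L A Aop Apos f fH.
  have /choice[e eE] : forall i, exists e, Pstar (f i) = pol2 (mu := k + a) (nu := k + b) e.
    by move=> i; apply: Hsp2P; exact: hPstar.1.
  have E i j : ip (a + b) (Pk (k + a) (k + b) k (tensorI (A i j) (Pstar (f j)))) (f i) =
      \sum_(l < (k + b).+1) 'C(k + b, l)%:R^-1 *
        ip (k + a) (A i j (pol ((e j) ^~ l))) (pol ((e i) ^~ l)).
    rewrite hPstar.2//; last first.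
      by rewrite eE tensorIE//; exact: Hsp2_pol2.
    by rewrite !eE ip2_tensorI.
  have -> : \sum_(i < L) \sum_(j < L)
      ip (a + b) (Pk (k + a) (k + b) k (tensorI (A i j) (Pstar (f j)))) (f i) =
    \sum_(l < (k + b).+1) 'C(k + b, l)%:R^-1 * \sum_(i < L) \sum_(j < L)
        ip (k + a) (A i j (pol ((e j) ^~ l))) (pol ((e i) ^~ l)).
    under eq_bigr do (under eq_bigr do rewrite E).
    under eq_bigr do rewrite exchange_big.
    rewrite exchange_big; apply: eq_bigr => l _ /=.
    by rewrite mulr_sumr; apply: eq_bigr => i _; rewrite mulr_sumr.
  (* For each l the inner double sum is the block form of A on the coefficients of w^l in the
     [Pstar (f i)], nonnegative by hypothesis. *)
  apply: sumr_ge0 => l _; apply: mulr_ge0; first by rewrite invr_ge0.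
  by apply: (Apos (fun i => pol ((e i) ^~ l))) => i; exact: Hsp_pol.
split; first exact: CPT.
split; last first.
  move=> A Aop; rewrite (isop_mx (fun d => ThE A d Aop)).2 -mulr_sumr.
  rewrite trace_conjugate_tensorI mulrA -rmorphM.
  have -> : r * ((a + b).+1%:R / (k + a).+1%:R) = 1.
    rewrite /r mulrA divfK ?divff// pnatr_eq0//.
  by rewrite mul1r.
split; first by move=> A Aop; exact: (isop_mx (fun d => ThE A d Aop)).1.
move=> L A Aop Apos f fH.
have -> : \sum_(i < L) \sum_(j < L) ip (a + b)
    (fun xi => r%:C * Pk (k + a) (k + b) k (tensorI (A i j) (Pstar (f j))) xi) (f i) =
  r%:C * \sum_(i < L) \sum_(j < L)
    ip (a + b) (Pk (k + a) (k + b) k (tensorI (A i j) (Pstar (f j)))) (f i).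
  rewrite mulr_sumr; apply: eq_bigr => i _; rewrite mulr_sumr; apply: eq_bigr => j _.
  by rewrite ipZl//; exact: (Top _ (Aop i j)).1.
by apply: mulr_ge0 => //; exact: CPT.2.
Qed.
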